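(* Let $\overline{M}$ be a smooth manifold of dimension $n+1$ with boundary $\partial M$ and interior $M$. Suppose that $\overline{M}$ is endowed with a projective structure and that $\nabla$ is an affine connection over $M$ contained in (the restriction to $M$ of) the projective class such that - $\nabla$ is special, i.e. preserves a non-zero section $\kappa$ of $\mathrm{vol}(M)$; - $\mathrm{Ric}^\nabla=0$; - $\nabla$ does not extend smoothly to any neighborhood of a boundary point. Then $\nabla$ is projectively compact of order $\alpha=1$, the section $\sigma:=\kappa^{-1/(n+2)}\in\Gamma(\mathcal{E}(1)|_M)$ smoothly extends by zero to a defining density for $\partial M$, and this extension satisfies the equation of the first BGG operator $$\sigma\mapsto\tilde\nabla_{(a}\tilde\nabla_{b)}\sigma+\tilde{\mathsf P}_{(ab)}\sigma$$ on $\overline{M}$ (i.e. this expression vanishes for any connection $\tilde\nabla$ in the projective class).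
   Context: All affine connections are torsion free; smooth means $C^\infty$. For a one-form $\Upsilon$, write $\hat\nabla=\nabla+\Upsilon$ for $\hat\nabla_\xi\eta=\nabla_\xi\eta+\Upsilon(\xi)\eta+\Upsilon(\eta)\xi$; connections so related are projectively equivalent, and a projective structure is an equivalence class. A local defining function for $\partial M$ is a smooth $\rho:U\to\mathbb{R}_{\ge0}$, $U\subset\overline{M}$ open, with $\rho^{-1}(\{0\})=U\cap\partial M$ and $d\rho\neq0$ along $U\cap\partial M$. $\nabla$ on $M$ is projectively compact of order $\alpha>0$ if near each boundary point there is a defining function $\rho$ such that $\nabla+\frac{d\rho}{\alpha\rho}$ extends smoothly to the boundary. Densities: $\mathrm{vol}(N)$ is the (trivializable) bundle of volume densities and $\mathcal{E}(w)=\mathrm{vol}(N)^{-w/(n+2)}$ for $\dim N=n+1$. Affine connections induce connections on these. A connection is special if it preserves a non-zero (nowhere vanishing; without restriction positive) section of $\mathrm{vol}$. A defining density for $\partial M$ is a section of a density bundle over $\overline M$ with zero locus $\partial M$ that in local trivializations around boundary points is represented (up to sign) by a defining function. $\tilde{\mathsf P}_{ab}$ is the projective Schouten tensor of $\tilde\nabla$; for special $\tilde\nabla$ it is $\tilde{\mathsf P}_{ab}=\frac{1}{n}\widetilde{\mathrm{Ric}}_{ab}$ and symmetric. The displayed operator $\Gamma(\mathcal{E}(1))\to\Gamma(S^2T^*\overline M\otimes\mathcal{E}(1))$ is independent of the choice of $\tilde\nabla$ in the projective class. *)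

(* Defs.v *)
From HB Require Import structures.
From mathcomp Require Import all_boot all_order all_algebra.
From mathcomp Require Import all_classical all_reals all_analysis.
From mathcomp Require Import ring.
Import Order.TTheory GRing.Theory Num.Theory.
Import numFieldNormedType.Exports.
Set Implicit Arguments.
Unset Strict Implicit.
Unset Printing Implicit Defensive.
Local Open Scope classical_set_scope.
Local Open Scope ring_scope.

(* Throughout, the dimension of the manifold is n.+1, tensor indices range over
   'I_n.+1, and coordinate 0 is the one transversal to the boundary. *)

Definition half_space (R : realType) (n : nat) : set 'rV[R]_n.+1 :=
  [set u | 0 <= u ord0 ord0].

(* Difference quotients relative to the half-space: two-sided, except for the
   derivative in direction 0 at a boundary point, which is one-sided.  At
   interior points [pder a f u] is the ordinary partial derivative. *)
Definition diff_quot (R : realType) (n : nat) (a : 'I_n.+1)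
    (f : 'rV[R]_n.+1 -> R) (u : 'rV[R]_n.+1) (h : R) : R :=
  h^-1 * (f (u + h *: delta_mx ord0 a) - f u).

Definition half_space_dnbhs (R : realType) (n : nat) (a : 'I_n.+1)
    (u : 'rV[R]_n.+1) : set_system R :=
  within [set h | half_space (u + h *: delta_mx ord0 a)] (0 : R)^'.

Definition pder (R : realType) (n : nat) (a : 'I_n.+1)
    (f : 'rV[R]_n.+1 -> R) (u : 'rV[R]_n.+1) : R :=
  lim (diff_quot a f u @ half_space_dnbhs a u).

Lemma half_space_dnbhs_interior (R : realType) (n : nat) (a : 'I_n.+1)
    (u : 'rV[R]_n.+1) :
  0 < u ord0 ord0 -> half_space_dnbhs a u = (0 : R)^'.
Proof.
move=> u0.
have S : \forall h \near (0 : R)^', half_space (u + h *: delta_mx ord0 a).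
  near=> h; rewrite /half_space /= !mxE eqxx /=.
  have hu : `|h| <= u ord0 ord0 by near: h; exact: dnbhs0_le.
  case: (ord0 == a); rewrite ?mulr1 ?mulr0 ?addr0 ?(ltW u0) //.
  by rewrite -[h]opprK subr_ge0 (le_trans _ hu) // -normrN ler_norm.
apply/seteqP; split => A; last exact: cvg_within.
rewrite /half_space_dnbhs /within /= => SA; near=> h.
by apply: (near SA h) => //; near: h.
Unshelve. all: by end_near.
Qed.

Lemma pder_interior (R : realType) (n : nat) (a : 'I_n.+1)
    (f : 'rV[R]_n.+1 -> R) (u : 'rV[R]_n.+1) :
  0 < u ord0 ord0 -> pder a f u = 'D_(delta_mx ord0 a) f u.
Proof.
move=> u0; rewrite /pder half_space_dnbhs_interior //.
rewrite /derive; congr (lim (_ @ 0^')).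
by apply/funext => h; rewrite /diff_quot /= [u + _]addrC.
Qed.

(* For V relatively open in the half-space: all iterated partial derivatives
   exist on V and are continuous on V, boundary points included. *)
Fixpoint Ck_on (R : realType) (n : nat) (k : nat) (V : set 'rV[R]_n.+1)
    (f : 'rV[R]_n.+1 -> R) : Prop :=
  {within V, continuous f} /\
  match k with
  | 0%N => True
  | k'.+1 => forall a : 'I_n.+1,
      (forall u, V u -> cvg (diff_quot a f u @ half_space_dnbhs a u)) /\
      Ck_on k' V (pder a f)
  end.

Definition smooth_on (R : realType) (n : nat) (V : set 'rV[R]_n.+1)
    (f : 'rV[R]_n.+1 -> R) : Prop := forall k, Ck_on k V f.

(* [coord i] and [param i] are total functions that are meaningful only on
   [dom i] and on its image. *)
Record bmanifold (R : realType) (n : nat) := BManifold {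
  carrier :> topologicalType;
  chart : Type;
  dom : chart -> set carrier;
  coord : chart -> carrier -> 'rV[R]_n.+1;
  param : chart -> 'rV[R]_n.+1 -> carrier;
  carrier_hausdorff : hausdorff_space carrier;
  carrier_second_countable : @second_countable carrier;
  dom_open : forall i, open (dom i);
  dom_cover : forall x, exists i, dom i x;
  coord_img : forall i, exists2 O : set 'rV[R]_n.+1,
    open O & coord i @` dom i = O `&` half_space (n := n);
  coordK : forall i x, dom i x -> param i (coord i x) = x;
  coord_continuous : forall i, {within dom i, continuous (coord i)};
  param_continuous : forall i, {within coord i @` dom i, continuous (param i)};
  transition_smooth : forall i j c,
    smooth_on (coord i @` (dom i `&` dom j))
      (fun u => coord j (param i u) ord0 c)
}.

Definition boundary (R : realType) (n : nat) (M : bmanifold R n) : set M :=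
  [set x | exists2 i, dom i x & coord i x ord0 ord0 = 0].
Arguments boundary {R n} M.

Definition minterior (R : realType) (n : nat) (M : bmanifold R n) : set M :=
  ~` boundary M.
Arguments minterior {R n} M.

Definition img (R : realType) (n : nat) (M : bmanifold R n) (N : set M)
    (i : chart M) : set 'rV[R]_n.+1 := coord i @` (dom i `&` N).

Definition trans (R : realType) (n : nat) (M : bmanifold R n) (i j : chart M)
    (u : 'rV[R]_n.+1) : 'rV[R]_n.+1 := coord j (param i u).

(* Entry (a, c) is the partial derivative of the c-th j-coordinate in the
   direction of the a-th i-coordinate. *)
Definition jacobian (R : realType) (n : nat) (M : bmanifold R n)
    (i j : chart M) (u : 'rV[R]_n.+1) : 'M[R]_n.+1 :=
  \matrix_(a, c) pder a (fun w => trans i j w ord0 c) u.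

Definition smooth_fun (R : realType) (n : nat) (M : bmanifold R n) (U : set M)
    (f : M -> R) : Prop :=
  forall i, smooth_on (img U i) (fun u => f (param i u)).

(* Geometric objects over an open set N of the manifold are families of
   components in the charts, subject to smoothness and to the transformation
   law over N; components outside the coordinate images of N are irrelevant. *)
Definition scalar_comp (R : realType) (n : nat) (M : bmanifold R n) :=
  chart M -> 'rV[R]_n.+1 -> R.

Definition covector_comp (R : realType) (n : nat) (M : bmanifold R n) :=
  chart M -> 'I_n.+1 -> 'rV[R]_n.+1 -> R.

(* [G i c a b u] is the Christoffel symbol G^c_{ab} in chart i at u, where
   nabla_{d_a} d_b = sum_c G^c_{ab} d_c. *)
Definition christoffel (R : realType) (n : nat) (M : bmanifold R n) :=
  chart M -> 'I_n.+1 -> 'I_n.+1 -> 'I_n.+1 -> 'rV[R]_n.+1 -> R.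

Definition one_form (R : realType) (n : nat) (M : bmanifold R n) (N : set M)
    (Ups : covector_comp M) : Prop :=
  (forall i a, smooth_on (img N i) (Ups i a)) /\
  (forall i j u, img (N `&` dom j) i u -> forall a,
     Ups i a u = \sum_c jacobian i j u a c * Ups j c (trans i j u)).

Definition differential (R : realType) (n : nat) (M : bmanifold R n)
    (f : M -> R) : covector_comp M :=
  fun i a u => pder a (fun w => f (param i w)) u.

Definition affine_connection (R : realType) (n : nat) (M : bmanifold R n)
    (N : set M) (G : christoffel M) : Prop :=
  [/\ forall i c a b, smooth_on (img N i) (G i c a b),
      forall i u, img N i u -> forall c a b, G i c a b u = G i c b a u &
      forall i j u, img (N `&` dom j) i u -> forall c a b,
        \sum_d jacobian i j u d c * G i d a b u =
        pder a (pder b (fun w => trans i j w ord0 c)) u +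
        \sum_e \sum_f jacobian i j u a e * jacobian i j u b f *
                      G j c e f (trans i j u)].

Definition agree_on (R : realType) (n : nat) (M : bmanifold R n) (N : set M)
    (G G' : christoffel M) : Prop :=
  forall i u, img N i u -> forall c a b, G i c a b u = G' i c a b u.

(* nabla_xi eta for vector fields given by their components in chart i. *)
Definition covd (R : realType) (n : nat) (M : bmanifold R n)
    (G : christoffel M) (i : chart M) (xi eta : 'I_n.+1 -> 'rV[R]_n.+1 -> R)
    (c : 'I_n.+1) (u : 'rV[R]_n.+1) : R :=
  \sum_a xi a u * pder a (eta c) u +
  \sum_a \sum_b G i c a b u * xi a u * eta b u.

Definition proj_change (R : realType) (n : nat) (M : bmanifold R n)
    (G : christoffel M) (Ups : covector_comp M) : christoffel M :=
  fun i c a b u =>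
    G i c a b u + Ups i a u * (b == c)%:R + Ups i b u * (a == c)%:R.

Lemma covd_proj_change (R : realType) (n : nat) (M : bmanifold R n)
    (G : christoffel M) (Ups : covector_comp M) i xi eta c u :
  covd (proj_change G Ups) i xi eta c u =
  covd G i xi eta c u + (\sum_a Ups i a u * xi a u) * eta c u +
                        (\sum_b Ups i b u * eta b u) * xi c u.
Proof.
rewrite /covd /proj_change -!addrA; congr (_ + _).
transitivity (\sum_a (\sum_b G i c a b u * xi a u * eta b u +
  (Ups i a u * xi a u * eta c u +
   (\sum_b Ups i b u * eta b u) * ((a == c)%:R * xi a u)))).
  apply: eq_bigr => a _.
  have -> : Ups i a u * xi a u * eta c u =
      \sum_b Ups i a u * xi a u * ((b == c)%:R * eta b u).
    rewrite (bigD1 c) //= big1 ?eqxx ?addr0 ?mul1r //.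
    by move=> b /negPf ->; rewrite mul0r mulr0.
  by rewrite mulr_suml -!big_split /=; apply: eq_bigr => b _; ring.
rewrite big_split big_split /= -mulr_suml -mulr_sumr.
congr (_ + (_ + _ * _)).
rewrite (bigD1 c) //= big1 ?eqxx ?addr0 ?mul1r //.
by move=> b /negPf ->; rewrite mul0r.
Qed.

Definition proj_equiv (R : realType) (n : nat) (M : bmanifold R n) (N : set M)
    (G G' : christoffel M) : Prop :=
  exists2 Ups, one_form N Ups & agree_on N G' (proj_change G Ups).

Definition projective_structure (R : realType) (n : nat) (M : bmanifold R n)
    (P : set (christoffel M)) : Prop :=
  exists2 G0, affine_connection [set: M] G0 &
    P = [set G | affine_connection [set: M] G /\ proj_equiv [set: M] G0 G].

(* The projective class on N generated by the restrictions of members of P. *)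
Definition proj_restrict (R : realType) (n : nat) (M : bmanifold R n)
    (N : set M) (P : set (christoffel M)) : set (christoffel M) :=
  [set G | affine_connection N G /\ exists2 G0, P G0 & proj_equiv N G0 G].

(* Sections of vol^p, expressed in the trivializations given by the powers of
   the coordinate volume densities. *)
Definition vol_section (R : realType) (n : nat) (M : bmanifold R n) (p : R)
    (N : set M) (s : scalar_comp M) : Prop :=
  (forall i, smooth_on (img N i) (s i)) /\
  (forall i j u, img (N `&` dom j) i u ->
     s i u = `|\det (jacobian i j u)| `^ p * s j (trans i j u)).

(* E(w) = vol^(weight_exp n w) *)
Definition weight_exp (R : realType) (n : nat) (w : R) : R := - w / n.+2%:R.

(* A connection acts on the coordinate volume density |dx| by
   nabla_a |dx| = - G^b_{ab} |dx|. *)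
Definition vol_covd (R : realType) (n : nat) (M : bmanifold R n)
    (G : christoffel M) (p : R) (s : scalar_comp M) : covector_comp M :=
  fun i a u => pder a (s i) u - p * (\sum_b G i b a b u) * s i u.

(* nabla_a nabla_b s *)
Definition vol_covd2 (R : realType) (n : nat) (M : bmanifold R n)
    (G : christoffel M) (p : R) (s : scalar_comp M) (i : chart M)
    (a b : 'I_n.+1) (u : 'rV[R]_n.+1) : R :=
  let mu := vol_covd G p s i in
  pder a (mu b) u - \sum_c G i c a b u * mu c u
    - p * (\sum_c G i c a c u) * mu b u.

Definition vol_parallel (R : realType) (n : nat) (M : bmanifold R n)
    (N : set M) (G : christoffel M) (p : R) (s : scalar_comp M) : Prop :=
  forall i u, img N i u -> forall a, vol_covd G p s i a u = 0.

(* R_{ab}^c_d, where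
   (nabla_a nabla_b - nabla_b nabla_a) xi^c = R_{ab}^c_d xi^d. *)
Definition riemann (R : realType) (n : nat) (M : bmanifold R n)
    (G : christoffel M) (i : chart M) (a b c d : 'I_n.+1)
    (u : 'rV[R]_n.+1) : R :=
  pder a (G i c b d) u - pder b (G i c a d) u +
  \sum_e (G i c a e u * G i e b d u - G i c b e u * G i e a d u).

Definition ricci (R : realType) (n : nat) (M : bmanifold R n)
    (G : christoffel M) (i : chart M) (b d : 'I_n.+1) (u : 'rV[R]_n.+1) : R :=
  \sum_a riemann G i a b a d u.

Definition ricci_flat (R : realType) (n : nat) (M : bmanifold R n)
    (N : set M) (G : christoffel M) : Prop :=
  forall i u, img N i u -> forall a b, ricci G i a b u = 0.

(* Projective Schouten tensor of an arbitrary torsion-free connection, i.e. the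
   solution of Ric_{ab} = n P_{ab} + (P_{ab} - P_{ba}); it equals Ric_{ab} / n
   when Ric is symmetric, in particular when the connection is special. *)
Definition schouten (R : realType) (n : nat) (M : bmanifold R n)
    (G : christoffel M) (i : chart M) (a b : 'I_n.+1) (u : 'rV[R]_n.+1) : R :=
  (n.+1%:R * ricci G i a b u + ricci G i b a u) / (n%:R * n.+2%:R).

Lemma ricci_schouten (R : realType) (n : nat) (n_gt0 : (0 < n)%N)
    (M : bmanifold R n) (G : christoffel M) i a b u :
  ricci G i a b u = n%:R * schouten G i a b u +
    (schouten G i a b u - schouten G i b a u).
Proof.
rewrite /schouten; have n0 : n%:R != 0 :> R by rewrite pnatr_eq0 -lt0n.
have n2 : n.+2%:R != 0 :> R by rewrite pnatr_eq0.
apply: (mulIf (mulf_neq0 n0 n2)).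
rewrite mulrDl mulrBl -[n%:R * _ * _]mulrA !divfK ?mulf_neq0 //.
by rewrite -[n.+2]addn2 -[n.+1]addn1 !natrD; ring.
Qed.

Definition bgg_operator (R : realType) (n : nat) (M : bmanifold R n)
    (G : christoffel M) (s : scalar_comp M) (i : chart M) (a b : 'I_n.+1)
    (u : 'rV[R]_n.+1) : R :=
  let p := weight_exp n (1 : R) in
  (vol_covd2 G p s i a b u + vol_covd2 G p s i b a u) / 2 +
  (schouten G i a b u + schouten G i b a u) / 2 * s i u.

Definition local_defining_function (R : realType) (n : nat)
    (M : bmanifold R n) (U : set M) (rho : M -> R) : Prop :=
  [/\ open U, smooth_fun U rho,
      forall x, U x -> 0 <= rho x,
      forall x, U x -> (rho x = 0 <-> boundary M x) &
      forall x i, U x -> boundary M x -> dom i x ->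
        exists a, differential rho i a (coord i x) != 0].

Definition projectively_compact (R : realType) (n : nat) (M : bmanifold R n)
    (alpha : R) (G : christoffel M) : Prop :=
  0 < alpha /\
  forall x : M, boundary M x -> exists U rho, [/\ U x,
    local_defining_function U rho &
    exists2 G', affine_connection U G' &
      agree_on (U `&` minterior M) G'
        (proj_change G
           (fun i a u => differential rho i a u / (alpha * rho (param i u))))].

Definition extends_near (R : realType) (n : nat) (M : bmanifold R n)
    (x : M) (G : christoffel M) : Prop :=
  exists2 U : set M, open U /\ U x &
  exists2 G', affine_connection U G' & agree_on (U `&` minterior M) G' G.

Definition defining_density (R : realType) (n : nat) (M : bmanifold R n)
    (p : R) (s : scalar_comp M) : Prop :=
  [/\ vol_section p [set: M] s,
      forall x i, dom i x -> (s i (coord i x) = 0 <-> boundary M x) &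
      forall x i, boundary M x -> dom i x ->
        exists2 U : set M, U x /\ U `<=` dom i &
        local_defining_function U (fun y => s i (coord i y)) \/
        local_defining_function U (fun y => - s i (coord i y))].

Definition scalar_pow (R : realType) (n : nat) (M : bmanifold R n)
    (s : scalar_comp M) (q : R) : scalar_comp M := fun i u => s i u `^ q.

Definition zero_extension (R : realType) (n : nat) (M : bmanifold R n)
    (s : scalar_comp M) : scalar_comp M :=
  fun i u => if `[< minterior M (param i u) >] then s i u else 0.

(* Main.v *)
(* In a chart, write nabla = T + Upsilon on the interior, with T in the projective
   class and smooth up to the boundary.  As kappa is nabla-parallel, the scale
   sigma satisfies nabla^T sigma = - Upsilon sigma, and Ric(nabla) = 0 says that
   nabla^T Upsilon = P^T + Upsilon Upsilon; hence nabla^T nabla^T sigma + P^T sigma = 0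
   in the interior.  So the jet (sigma, nabla^T sigma) solves a closed linear system
   whose coefficients are smooth up to the boundary: it is bounded, and bounded away
   from zero, hence Lipschitz, hence it extends smoothly to the boundary, where it
   is nonzero.  If sigma were nonzero at a boundary point, then
   Upsilon = - sigma^-1 nabla^T sigma, and with it nabla, would extend there; so
   sigma vanishes along the boundary while its differential does not.  Finally
   Upsilon + d sigma / sigma is smooth up to the boundary, which is projective
   compactness of order 1. *)
Require Import Defs.
From mathcomp Require Import all_boot all_order all_algebra.
From mathcomp Require Import all_classical all_reals all_analysis.
From mathcomp Require Import ring lra.
(* Imported again because [vector.coord] would otherwise hide [Defs.coord]. *)
Require Import Defs.
Import Order.TTheory GRing.Theory Num.Theory.
Import numFieldNormedType.Exports.
Set Implicit Arguments.
Unset Strict Implicit.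
Unset Printing Implicit Defensive.
Local Open Scope classical_set_scope.
Local Open Scope ring_scope.

(** * Calculus on the half-space *)

(** The obstacle is that smoothness up to the boundary is defined by iterated, partly one-sided
    partial derivatives, while the geometry is known only in the interior. The bridge is a mean
    value inequality on cubes whose constant involves interior derivatives alone; continuity carries
    it to the boundary. It makes a function totally differentiable at a boundary point once the
    function and the candidates for its partial derivatives are continuous up to that point. This
    gives the chain rule between charts, and it shows that a merely continuous extension of the jet
    still solves the linear system on the boundary, after which the system itself yields all higher
    derivatives. The reference connection is an arbitrary member of the class, which may preserve no
    volume density; this is why the Schouten tensor appears in its general, possibly non-symmetric
    form. *)

Lemma cvg_near (T : Type) (U : nbhsType) (F : set_system T) {FF : Filter F}
    (f g : T -> U) (l : U) :
  f @ F --> l -> (\forall x \near F, f x = g x) -> g @ F --> l.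
Proof. by move=> fl fg; apply: cvg_trans fl; exact: near_eq_cvg. Qed.

Section HalfSpaceCalculus.
Context {R : realType} {n : nat}.
Implicit Types (f g : 'rV[R]_n.+1 -> R) (u v w : 'rV[R]_n.+1) (a : 'I_n.+1)
  (V W : set 'rV[R]_n.+1).

Notation H := (@half_space R n).

(** One filter per point instead of one per domain: for every relatively open [V] containing [u] it
    coincides with [within V (nbhs u)] (see [within_ropen]), so restricting a function or arguing
    locally does not change the limits involved. *)
Definition hnbhs u : set_system 'rV[R]_n.+1 := within H (nbhs u).

Global Instance hnbhs_filter u : Filter (hnbhs u).
Proof. exact: within_filter. Qed.

Definition ropen V := V `<=` H /\ forall u, V u -> hnbhs u V.

Definition hcts f u := f @ hnbhs u --> f u.

Definition has_pder a f u (l : R) := diff_quot a f u @ half_space_dnbhs a u --> l.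

Lemma nbhs_cubeP u (A : set 'rV[R]_n.+1) :
  nbhs u A <-> exists2 r : R, 0 < r &
    forall v, (forall c, `|v ord0 c - u ord0 c| < r) -> A v.
Proof.
rewrite nbhs_ballP; split=> -[r r0 rA]; exists r => // v uv; apply: rA.
  split=> // i c; rewrite [i]ord1 /ball /= distrC; exact: uv.
by case: uv => _ uv c; have := uv ord0 c; rewrite /ball /= distrC.
Qed.

Lemma hnbhs_cubeP u (A : set 'rV[R]_n.+1) :
  hnbhs u A <-> exists2 r : R, 0 < r &
    forall v, H v -> (forall c, `|v ord0 c - u ord0 c| < r) -> A v.
Proof.
split=> [/nbhs_cubeP[r r0 rA]|[r r0 rA]]; last first.
  by apply/nbhs_cubeP; exists r => // v uv Hv; exact: rA.
by exists r => // v Hv uv; exact: rA.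
Qed.

Global Instance half_space_dnbhs_filter a u : Filter (half_space_dnbhs a u).
Proof. exact: within_filter. Qed.

(** Small positive steps in a coordinate direction never leave the half-space, so even the one-sided
    filter at a boundary point is proper. Hence limits of difference quotients are unique and [pder]
    returns the expected value. *)
Lemma half_space_dnbhs_proper a u : H u -> ProperFilter (half_space_dnbhs a u).
Proof.
move=> Hu; apply: Build_ProperFilter_ex => A; rewrite /half_space_dnbhs.
move=> [r /= r0 rA]; exists (r / 2); apply: rA => //=.
- rewrite sub0r normrN gtr0_norm ?divr_gt0 //.
  by rewrite ltr_pdivrMr // ltr_pMr // ltr1n.
- by rewrite gt_eqF // divr_gt0.
- rewrite /half_space /= !mxE eqxx /= addr_ge0 // mulr_ge0 ?ler0n //.
  by rewrite ltW // divr_gt0.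
Qed.

Lemma line_cvg a u :
  (fun h : R => u + h *: delta_mx ord0 a) @ half_space_dnbhs a u --> hnbhs u.
Proof.
move=> A /hnbhs_cubeP[r r0 rA].
exists r => //= h; rewrite /= sub0r normrN => hr _ Hh; apply: rA => // c.
rewrite !mxE eqxx /= addrAC subrr add0r.
by case: (c == a); rewrite ?mulr1 // mulr0 normr0.
Qed.

Lemma hnbhs_line a u (A : set 'rV[R]_n.+1) : hnbhs u A ->
  \forall h \near half_space_dnbhs a u, A (u + h *: delta_mx ord0 a).
Proof. exact: line_cvg. Qed.

Lemma hnbhs_self u (A : set 'rV[R]_n.+1) : H u -> hnbhs u A -> A u.
Proof.
move=> Hu /hnbhs_cubeP[r r0 rA]; apply: rA => // c.
by rewrite subrr normr0.
Qed.

Lemma near_dnbhs_neq0 a u : \forall h \near half_space_dnbhs a u, h != 0.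
Proof. by exists 1 => //= h _ h0 _. Qed.

Lemma has_pder_derive a f u l : H u -> has_pder a f u l -> pder a f u = l.
Proof.
move=> Hu fl; have PF := half_space_dnbhs_proper a Hu.
exact: (cvg_lim _ fl).
Qed.

Lemma cvg_has_pder a f u : cvg (diff_quot a f u @ half_space_dnbhs a u) ->
  has_pder a f u (pder a f u).
Proof. by []. Qed.

Lemma has_pder_near a f g u l : H u -> (\forall v \near hnbhs u, f v = g v) ->
  has_pder a f u l -> has_pder a g u l.
Proof.
move=> Hu fg; apply: cvg_trans; apply: near_eq_cvg.
have fgu : f u = g u := hnbhs_self Hu fg.
near=> h; rewrite /diff_quot fgu; congr (_ * (_ - _)).
by near: h; apply: hnbhs_line fg.
Unshelve. all: by end_near. Qed.

Lemma pder_near a f g u : H u -> (\forall v \near hnbhs u, f v = g v) ->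
  pder a f u = pder a g u.
Proof.
move=> Hu fg; have fgu : f u = g u := hnbhs_self Hu fg.
have E : \forall h \near half_space_dnbhs a u, diff_quot a f u h = diff_quot a g u h.
  near=> h; rewrite /diff_quot fgu; congr (_ * (_ - _)).
  by near: h; apply: hnbhs_line fg.
rewrite /pder; congr lim; apply/seteqP; split => A; apply: near_eq_cvg => //.
by near=> h; apply/esym; near: h.
Unshelve. all: by end_near. Qed.

(** Continuity along the coordinate line only, read off from [f u + h * diff_quot a f u h]. This is
    exactly what the product rule and composition with a one-variable function use. *)
Lemma has_pder_cts a f u l : has_pder a f u l ->
  f (u + h *: delta_mx ord0 a) @[h --> half_space_dnbhs a u] --> f u.
Proof.
move=> fl.
have h0 : id @ half_space_dnbhs a u --> (0 : R).
  by apply: (cvg_within_filter (F := 0^')); exact: cvg_within.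
apply: (@cvg_near _ _ _ _ (fun h => f u + h * diff_quot a f u h)).
  rewrite -[X in _ --> X]addr0 -(mul0r l).
  by apply: cvgD; [exact: cvg_cst|exact: cvgM].
near=> h; have hn0 : h != 0 by near: h; exact: near_dnbhs_neq0.
by rewrite /diff_quot mulrA divff // mul1r addrC subrK.
Unshelve. all: by end_near. Qed.

Lemma has_pder_cst a (c : R) u : has_pder a (fun=> c) u 0.
Proof.
rewrite /has_pder; have -> : diff_quot a (fun=> c) u = fun=> 0.
  by apply/funext => h; rewrite /diff_quot subrr mulr0.
exact: cvg_cst.
Qed.

Lemma has_pderD a f g u l m : has_pder a f u l -> has_pder a g u m ->
  has_pder a (fun v => f v + g v) u (l + m).
Proof.
move=> fl gm; rewrite /has_pder.
rewrite (_ : diff_quot _ _ _ = diff_quot a f u \+ diff_quot a g u).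
  exact: cvgD.
by apply/funext => h; rewrite /= /diff_quot; ring.
Qed.

Lemma has_pderM a f g u l m : has_pder a f u l -> has_pder a g u m ->
  has_pder a (fun v => f v * g v) u (l * g u + f u * m).
Proof.
move=> fl gm; have gc := has_pder_cts gm; rewrite /has_pder.
rewrite (_ : diff_quot _ _ _ = fun h => diff_quot a f u h *
  g (u + h *: delta_mx ord0 a) + f u * diff_quot a g u h).
  by apply: cvgD; apply: cvgM => //; exact: cvg_cst.
by apply/funext => h; rewrite /diff_quot; ring.
Qed.

Lemma has_pderN a f u l : has_pder a f u l -> has_pder a (fun v => - f v) u (- l).
Proof.
move=> fl; rewrite /has_pder.
rewrite (_ : diff_quot _ _ _ = \- diff_quot a f u); first exact: cvgN.
by apply/funext => h; rewrite /= /diff_quot; ring.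
Qed.

Lemma has_pder_sum a (I : Type) (r : seq I) (P : pred I)
    (F : I -> 'rV[R]_n.+1 -> R) u (L : I -> R) :
  (forall i, P i -> has_pder a (F i) u (L i)) ->
  has_pder a (fun v => \sum_(i <- r | P i) F i v) u (\sum_(i <- r | P i) L i).
Proof.
move=> FL; elim: r => [|i r IH].
  have -> : (fun v => \sum_(i <- [::] | P i) F i v) = fun=> 0.
    by apply/funext => v; rewrite big_nil.
  by rewrite big_nil; exact: has_pder_cst.
have -> : (fun v => \sum_(i <- i :: r | P i) F i v) =
    fun v => (if P i then F i v else 0) + \sum_(i <- r | P i) F i v.
  by apply/funext => v; rewrite big_cons; case: ifP; rewrite ?add0r.
rewrite big_cons; case: ifPn => [Pi|_]; first by apply: has_pderD => //; exact: FL.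
by rewrite -[\sum_(_ <- _ | _) _]add0r; apply: has_pderD => //; exact: has_pder_cst.
Qed.

(** Carathéodory's form of the derivative: the slope [psi], given the value [d] at [f u], is
    continuous there, and the quotient factors through it even for those [h] where [f] takes the
    value [f u] again. *)
Lemma has_pder_comp1 a (phi : R -> R) f u d l :
  is_derive (f u) 1 phi d -> has_pder a f u l ->
  has_pder a (fun v => phi (f v)) u (d * l).
Proof.
move=> [phi_d phi_e] fl.
pose psi y := if y == f u then d else (phi y - phi (f u)) / (y - f u).
have psic : psi @ f u --> d.
  apply/cvgrPdist_lt => e e0.
  move: phi_d; rewrite /derivable -/(derive _ _ _) => phi_d.
  have {}phi_d : (fun h : R => h^-1 *: (phi (h *: 1 + f u) - phi (f u))) @ 0^' --> d.
    by rewrite -phi_e.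
  move/cvgrPdist_lt: phi_d => /(_ e e0) [r /= r0 rP].
  exists r => //= y ry; rewrite /psi; case: eqVneq => [_|yu].
    by rewrite subrr normr0.
  have := rP (y - f u); rewrite /= sub0r normrN -[`|y - _|]distrC subr_eq0.
  by move=> /(_ ry yu); rewrite /GRing.scale /= mulr1 subrK [_^-1 * _]mulrC.
rewrite /has_pder (_ : diff_quot _ _ _ = fun h =>
  psi (f (u + h *: delta_mx ord0 a)) * diff_quot a f u h).
  by apply: cvgM => //; apply: cvg_comp psic; exact: has_pder_cts fl.
apply/funext => h; rewrite /diff_quot /psi; case: eqVneq => [->|yu].
  by rewrite !subrr !mulr0.
by rewrite mulrCA divfK // subr_eq0.
Qed.

Lemma has_pder_coord a c u : has_pder a (fun v => v ord0 c) u (a == c)%:R.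
Proof.
have : (fun=> (a == c)%:R : R) @ half_space_dnbhs a u --> ((a == c)%:R : R).
  exact: cvg_cst.
move=> /cvg_near; apply.
near=> h; have hn0 : h != 0 by near: h; exact: near_dnbhs_neq0.
rewrite /diff_quot !mxE eqxx /= addrAC subrr add0r mulrA mulVf // mul1r.
by rewrite eq_sym.
Unshelve. all: by end_near. Qed.

Lemma hcts_cst (c : R) u : hcts (fun=> c) u.
Proof. exact: cvg_cst. Qed.

Lemma hctsD f g u : hcts f u -> hcts g u -> hcts (fun v => f v + g v) u.
Proof. by move=> fu gu; exact: (cvgD fu gu). Qed.

Lemma hctsM f g u : hcts f u -> hcts g u -> hcts (fun v => f v * g v) u.
Proof. by move=> fu gu; exact: (cvgM fu gu). Qed.

Lemma hcts_coord c u : hcts (fun v => v ord0 c) u.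
Proof.
apply/cvgrPdist_lt => e e0; apply/hnbhs_cubeP; exists e => // v _ uv.
by rewrite distrC.
Qed.

Lemma hcts_sum (I : Type) (s : seq I) (F : I -> 'rV[R]_n.+1 -> R) u :
  (forall i, hcts (F i) u) -> hcts (fun v => \sum_(i <- s) F i v) u.
Proof.
move=> Fc; elim: s => [|i s IH].
  rewrite (_ : (fun _ => _) = fun=> 0); first exact: hcts_cst.
  by apply/funext => v; rewrite big_nil.
rewrite (_ : (fun _ => _) = fun v => F i v + \sum_(j <- s) F j v); first exact: hctsD.
by apply/funext => v; rewrite big_cons.
Qed.

Lemma hcts_near f g u : H u -> (\forall v \near hnbhs u, f v = g v) ->
  hcts f u -> hcts g u.
Proof.
move=> Hu fg; rewrite /hcts -(hnbhs_self Hu fg).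
exact: cvg_trans (near_eq_cvg _).
Qed.

Lemma ropen_hnbhs V u : ropen V -> V u -> hnbhs u V.
Proof. by case=> _; exact. Qed.

Lemma ropen_sub V u : ropen V -> V u -> H u.
Proof. by case=> + _; exact. Qed.

Lemma ropen_near_eq V f g u : ropen V -> V u -> (forall v, V v -> f v = g v) ->
  \forall v \near hnbhs u, f v = g v.
Proof. by move=> oV Vu fg; apply: filterS (ropen_hnbhs oV Vu) => v /fg. Qed.

Lemma within_ropen V u : ropen V -> V u -> within V (nbhs u) = hnbhs u.
Proof.
move=> oV Vu; apply/seteqP; split => A AV.
  have VV : nbhs u (fun v => H v -> V v) := ropen_hnbhs oV Vu.
  have {}AV : nbhs u (fun v => V v -> A v) := AV.
  by apply: (filterS2 _ _ AV VV) => v VA HV Hv; apply: VA; exact: HV.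
have {}AV : nbhs u (fun v => H v -> A v) := AV.
by apply: (filterS _ AV) => v HA Vv; apply: HA; exact: (ropen_sub oV).
Qed.

Lemma within_hcts V f : ropen V ->
  {within V, continuous f} <-> forall u, V u -> hcts f u.
Proof.
move=> oV; split.
  move=> /subspace_continuousP fc u Vu; rewrite /hcts -(within_ropen oV Vu).
  exact: fc.
move=> fc; apply/subspace_continuousP => u Vu; rewrite (within_ropen oV Vu).
exact: fc.
Qed.

End HalfSpaceCalculus.

(** * Closure properties of functions that are smooth up to the boundary *)

Section SmoothFunctions.
Context {R : realType} {n : nat}.
Implicit Types (f g : 'rV[R]_n.+1 -> R) (u v w : 'rV[R]_n.+1) (a : 'I_n.+1)
  (V W : set 'rV[R]_n.+1) (k : nat).

Lemma Ck_on_hcts k V f u : ropen V -> Ck_on k V f -> V u -> hcts f u.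
Proof. by move=> oV; case: k => [|k] [fc _]; exact: (within_hcts f oV).1 fc u. Qed.

Lemma Ck_on_cvg k V f a u : Ck_on k.+1 V f -> V u -> has_pder a f u (pder a f u).
Proof. by move=> [_ /(_ a)[fa _]] Vu; exact/cvg_has_pder/fa. Qed.

Lemma Ck_on_pder k V f a : Ck_on k.+1 V f -> Ck_on k V (pder a f).
Proof. by move=> [_ /(_ a)[]]. Qed.

Lemma Ck_on_eq k V f g : ropen V -> (forall v, V v -> f v = g v) ->
  Ck_on k V f -> Ck_on k V g.
Proof.
move=> oV; have fgc k' f' g' : (forall v, V v -> f' v = g' v) -> Ck_on k' V f' ->
    {within V, continuous g'}.
  move=> fg fk; apply/(within_hcts _ oV) => u Vu.
  apply: (hcts_near (ropen_sub oV Vu) (ropen_near_eq oV Vu fg)).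
  exact: Ck_on_hcts oV fk Vu.
elim: k f g => [|k IH] f g fg fk; (split; first exact: fgc fg fk) => //.
move=> a; split=> [u Vu|].
  apply: cvgP; apply: (has_pder_near (ropen_sub oV Vu) (ropen_near_eq oV Vu fg)).
  exact: Ck_on_cvg fk Vu.
apply: IH (Ck_on_pder a fk) => v Vv.
exact: pder_near (ropen_sub oV Vv) (ropen_near_eq oV Vv fg).
Qed.

(** The induction step for all closure properties: it allows an explicit formula [g a] for the
    derivative in place of the limit [pder a f], so that the induction hypothesis applies to the
    formula. *)
Lemma Ck_onS_has_pder k V f (g : 'I_n.+1 -> 'rV[R]_n.+1 -> R) : ropen V ->
  (forall u, V u -> hcts f u) ->
  (forall a u, V u -> has_pder a f u (g a u)) ->
  (forall a, Ck_on k V (g a)) -> Ck_on k.+1 V f.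
Proof.
move=> oV fc fg gk; split; first exact/within_hcts.
move=> a; split=> [u Vu|]; first by apply: cvgP; exact: fg.
apply: (Ck_on_eq oV _ (gk a)) => v Vv; apply/esym.
by apply: has_pder_derive (fg a v Vv); exact: ropen_sub oV Vv.
Qed.

Lemma Ck_onW k V f : ropen V -> Ck_on k.+1 V f -> Ck_on k V f.
Proof.
move=> oV; elim: k f => [|k IH] f fk; first by case: fk.
apply: (@Ck_onS_has_pder _ _ _ (fun a => pder a f)) => //.
- by move=> u; exact: Ck_on_hcts fk.
- by move=> a u; exact: Ck_on_cvg fk.
- by move=> a; apply: IH; exact: Ck_on_pder.
Qed.

Lemma Ck_on_sub k V W f : ropen V -> ropen W -> W `<=` V ->
  Ck_on k V f -> Ck_on k W f.
Proof.
move=> oV oW WV; elim: k f => [|k IH] f fk.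
  split=> //; apply/within_hcts => // u /WV; exact: Ck_on_hcts fk.
apply: (@Ck_onS_has_pder _ _ _ (fun a => pder a f)) => //.
- by move=> u /WV; exact: Ck_on_hcts fk.
- by move=> a u /WV; exact: Ck_on_cvg fk.
- by move=> a; apply: IH; exact: Ck_on_pder.
Qed.

Lemma Ck_on_local k V f : ropen V ->
  (forall u, V u -> exists W, [/\ ropen W, W u & Ck_on k W f]) -> Ck_on k V f.
Proof.
move=> oV; elim: k f => [|k IH] f fk.
  by split=> //; apply/within_hcts => // u /fk [W [oW Wu /Ck_on_hcts]]; exact.
apply: (@Ck_onS_has_pder _ _ _ (fun a => pder a f)) => //.
- by move=> u /fk[W [oW Wu fW]]; exact: Ck_on_hcts fW Wu.
- by move=> a u /fk[W [oW Wu fW]]; exact: Ck_on_cvg fW Wu.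
- move=> a; apply: IH => u /fk[W [oW Wu fW]]; exists W; split=> //.
  exact: Ck_on_pder.
Qed.

Lemma Ck_on_cst k V (c : R) : ropen V -> Ck_on k V (fun=> c).
Proof.
move=> oV; elim: k c => [|k IH] c.
  by split=> //; apply/within_hcts => // u _; exact: hcts_cst.
apply: (@Ck_onS_has_pder _ _ _ (fun a => fun=> 0)) => // [u _|a u _].
  exact: hcts_cst.
exact: has_pder_cst.
Qed.

Lemma Ck_onD k V f g : ropen V -> Ck_on k V f -> Ck_on k V g ->
  Ck_on k V (fun v => f v + g v).
Proof.
move=> oV; elim: k f g => [|k IH] f g fk gk.
  split=> //; apply/within_hcts => // u Vu.
  by apply: hctsD; [exact: Ck_on_hcts fk Vu|exact: Ck_on_hcts gk Vu].
apply: (@Ck_onS_has_pder _ _ _ (fun a v => pder a f v + pder a g v)) => //.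
- by move=> u Vu; apply: hctsD; [exact: Ck_on_hcts fk Vu|exact: Ck_on_hcts gk Vu].
- by move=> a u Vu; apply: has_pderD; [exact: Ck_on_cvg fk Vu|exact: Ck_on_cvg gk Vu].
- by move=> a; apply: IH; exact: Ck_on_pder.
Qed.

Lemma Ck_onM k V f g : ropen V -> Ck_on k V f -> Ck_on k V g ->
  Ck_on k V (fun v => f v * g v).
Proof.
move=> oV; elim: k f g => [|k IH] f g fk gk.
  split=> //; apply/within_hcts => // u Vu.
  by apply: hctsM; [exact: Ck_on_hcts fk Vu|exact: Ck_on_hcts gk Vu].
apply: (@Ck_onS_has_pder _ _ _ (fun a v => pder a f v * g v + f v * pder a g v)) => //.
- by move=> u Vu; apply: hctsM; [exact: Ck_on_hcts fk Vu|exact: Ck_on_hcts gk Vu].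
- by move=> a u Vu; apply: has_pderM; [exact: Ck_on_cvg fk Vu|exact: Ck_on_cvg gk Vu].
- by move=> a; apply: Ck_onD => //; apply: IH; (exact: Ck_on_pder || exact: Ck_onW).
Qed.

Lemma Ck_on_sum k V (I : Type) (r : seq I) (P : pred I)
    (F : I -> 'rV[R]_n.+1 -> R) : ropen V ->
  (forall i, P i -> Ck_on k V (F i)) ->
  Ck_on k V (fun v => \sum_(i <- r | P i) F i v).
Proof.
move=> oV Fk; elim: r => [|i r IH].
  apply: Ck_on_eq (Ck_on_cst k 0 oV) => // v _; by rewrite big_nil.
have [Pi|/negPf Pi] := boolP (P i).
  apply: Ck_on_eq (Ck_onD oV (Fk i Pi) IH) => // v _; by rewrite big_cons Pi.
by apply: Ck_on_eq IH => // v _; rewrite big_cons Pi.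
Qed.

Lemma Ck_onV k V f : ropen V -> (forall u, V u -> f u != 0) ->
  Ck_on k V f -> Ck_on k V (fun v => (f v)^-1).
Proof.
move=> oV f0; elim: k f f0 => [|k IH] f f0 fk.
  split=> //; apply/within_hcts => // u Vu.
  by apply: cvgV; [exact: f0|exact: Ck_on_hcts fk Vu].
apply: (@Ck_onS_has_pder _ _ _
  (fun a v => - 1 * ((f v)^-1 * (f v)^-1) * pder a f v)) => //.
- by move=> u Vu; apply: cvgV; [exact: f0|exact: Ck_on_hcts fk Vu].
- move=> a u Vu; apply: has_pder_comp1; last exact: Ck_on_cvg fk Vu.
  rewrite mulN1r -invfM -expr2.
  have -> : - (f u ^+ 2)^-1 = - (f u) ^- 2 *: (1 : R) by rewrite /GRing.scale /= mulr1.
  by apply: is_deriveV; exact: f0.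
- have fVk := IH f f0 (Ck_onW oV fk).
  move=> a; apply: Ck_onM; [by []| |exact: Ck_on_pder].
  by apply: Ck_onM; [by []|exact: Ck_on_cst|exact: Ck_onM].
Qed.

Lemma smooth_eq V f g : ropen V -> (forall v, V v -> f v = g v) ->
  smooth_on V f -> smooth_on V g.
Proof. by move=> oV fg fs k; exact: Ck_on_eq fg (fs k). Qed.

Lemma smooth_sub V W f : ropen V -> ropen W -> W `<=` V ->
  smooth_on V f -> smooth_on W f.
Proof. by move=> oV oW WV fs k; exact: Ck_on_sub WV (fs k). Qed.

Lemma smooth_local V f : ropen V ->
  (forall u, V u -> exists W, [/\ ropen W, W u & smooth_on W f]) -> smooth_on V f.
Proof.
move=> oV fs k; apply: Ck_on_local => // u /fs[W [oW Wu fW]].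
by exists W; split.
Qed.

Lemma smooth_hcts V f u : ropen V -> smooth_on V f -> V u -> hcts f u.
Proof. by move=> oV /(_ 0%N); exact: Ck_on_hcts. Qed.

Lemma smooth_has_pder V f a u : smooth_on V f -> V u -> has_pder a f u (pder a f u).
Proof. by move=> /(_ 1%N); exact: Ck_on_cvg. Qed.

Lemma smooth_pder V f a : smooth_on V f -> smooth_on V (pder a f).
Proof. by move=> fs k; exact: Ck_on_pder (fs k.+1). Qed.

Lemma smooth_cst V (c : R) : ropen V -> smooth_on V (fun=> c).
Proof. by move=> oV k; exact: Ck_on_cst. Qed.

Lemma smoothD V f g : ropen V -> smooth_on V f -> smooth_on V g ->
  smooth_on V (fun v => f v + g v).
Proof. by move=> oV fs gs k; exact: Ck_onD. Qed.

Lemma smoothM V f g : ropen V -> smooth_on V f -> smooth_on V g ->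
  smooth_on V (fun v => f v * g v).
Proof. by move=> oV fs gs k; exact: Ck_onM. Qed.

Lemma smoothZ V (c : R) f : ropen V -> smooth_on V f -> smooth_on V (fun v => c * f v).
Proof. by move=> oV fs; apply: smoothM => //; exact: smooth_cst. Qed.

Lemma smoothN V f : ropen V -> smooth_on V f -> smooth_on V (fun v => - f v).
Proof.
move=> oV /(smoothZ (-1) oV) fs; apply: smooth_eq fs => // v _; by rewrite mulN1r.
Qed.

Lemma smoothB V f g : ropen V -> smooth_on V f -> smooth_on V g ->
  smooth_on V (fun v => f v - g v).
Proof. by move=> oV fs gs; apply: smoothD => //; exact: smoothN. Qed.

Lemma smooth_sum V (I : Type) (r : seq I) (P : pred I)
    (F : I -> 'rV[R]_n.+1 -> R) : ropen V ->
  (forall i, P i -> smooth_on V (F i)) ->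
  smooth_on V (fun v => \sum_(i <- r | P i) F i v).
Proof. by move=> oV Fs k; apply: Ck_on_sum => // i Pi; exact: Fs. Qed.

Lemma smoothV V f : ropen V -> (forall u, V u -> f u != 0) ->
  smooth_on V f -> smooth_on V (fun v => (f v)^-1).
Proof. by move=> oV f0 fs k; exact: Ck_onV. Qed.

End SmoothFunctions.

(** * Mean value inequalities and the chain rule *)

Section MeanValue.
Context {R : realType} {n : nat}.
Implicit Types (f : 'rV[R]_n.+1 -> R) (g : 'I_n.+1 -> 'rV[R]_n.+1 -> R)
  (u v w y z : 'rV[R]_n.+1) (a c : 'I_n.+1) (V W : set 'rV[R]_n.+1).

Notation H := (@half_space R n).

(** Cubes suit partial derivatives: two points can be joined inside a cube by segments parallel to
    the axes. The matching distance is the sum [dist1] of the coordinate differences. *)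
Definition cube u (r : R) : set 'rV[R]_n.+1 :=
  [set v | forall c, `|v ord0 c - u ord0 c| < r].

Definition hcube u r : set 'rV[R]_n.+1 := cube u r `&` H.

Definition icube u r : set 'rV[R]_n.+1 := cube u r `&` [set v | 0 < v ord0 ord0].

Definition dist1 y z : R := \sum_c `|y ord0 c - z ord0 c|.

Lemma cube_open u r v : cube u r v -> nbhs v (cube u r).
Proof.
move=> uv; apply/nbhs_cubeP.
pose s := \big[Order.min/1]_c (r - `|v ord0 c - u ord0 c|).
exists s; first by rewrite /s; elim/big_ind: _ => // [x y x0 y0|c _];
  rewrite ?lt_min ?x0 ?y0 ?subr_gt0.
move=> w vw c; rewrite -(subrK (v ord0 c) (w ord0 c)) -addrA.
apply: le_lt_trans (ler_normD _ _) _; rewrite -ltrBrDr.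
by apply: lt_le_trans (vw c) _; rewrite /s (bigD1 c) //= ge_min lexx.
Qed.

Lemma cube_center u r : 0 < r -> cube u r u.
Proof. by move=> r0 c; rewrite subrr normr0. Qed.

Lemma hcube_center u r : 0 < r -> H u -> hcube u r u.
Proof. by move=> r0 Hu; split=> //; exact: cube_center. Qed.

Lemma ropen_hcube u r : ropen (hcube u r).
Proof.
split=> [v []//|v [uv Hv]].
have cv := cube_open uv.
have : nbhs v (fun w => H w -> hcube u r w) by apply: filterS cv => w ? ?; split.
by [].
Qed.

Lemma pos_open v : 0 < v ord0 ord0 -> nbhs v [set w : 'rV[R]_n.+1 | 0 < w ord0 ord0].
Proof.
move=> v0; apply/nbhs_cubeP; exists (v ord0 ord0) => // w /(_ ord0).
by rewrite /= ltr_distl subrr => /andP[].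
Qed.

Lemma ropen_icube u r : ropen (icube u r).
Proof.
split=> [v [_ /ltW]//|v [uv Hv]].
have cv := cube_open uv; have pv := pos_open Hv.
have : nbhs v (fun w => H w -> icube u r w).
  by apply: (filterS2 _ _ cv pv) => w ? ? _; split.
by [].
Qed.

Lemma icube_hcube u r : icube u r `<=` hcube u r.
Proof. by move=> v [? /ltW]. Qed.

Lemma hcube_near u (A : set 'rV[R]_n.+1) : hnbhs u A ->
  exists2 r, 0 < r & hcube u r `<=` A.
Proof. by move/hnbhs_cubeP => [r r0 rA]; exists r => // v [? ?]; exact: rA. Qed.

Lemma near_hcube u r : 0 < r -> hnbhs u (hcube u r).
Proof. by move=> r0; apply/hnbhs_cubeP; exists r. Qed.

(** The segment lies in the open half-space, where [has_pder] is an ordinary two-sided derivative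
    along the line, so the one-variable mean value theorem applies. *)
Lemma axis_lipschitz a f (g : 'rV[R]_n.+1 -> R) w (s t L : R) : s <= t ->
  (forall x, s <= x <= t ->
    [/\ 0 < (w + x *: delta_mx ord0 a) ord0 ord0,
        has_pder a f (w + x *: delta_mx ord0 a) (g (w + x *: delta_mx ord0 a)) &
        `|g (w + x *: delta_mx ord0 a)| <= L]) ->
  `|f (w + t *: delta_mx ord0 a) - f (w + s *: delta_mx ord0 a)| <= L * (t - s).
Proof.
move=> st fg; pose p (x : R) := w + x *: delta_mx ord0 a.
have fd x : s <= x <= t -> is_derive x 1 (f \o p) (g (p x)).
  move=> /fg[px0]; rewrite /has_pder half_space_dnbhs_interior // => fx _.
  have {}fx : (fun h : R => h^-1 *: ((f \o p) (h *: 1 + x) - (f \o p) x)) @ 0^'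
      --> g (p x).
    apply: cvg_trans fx; apply: near_eq_cvg; near=> h.
    rewrite /diff_quot /GRing.scale /= /p mulr1 scalerDl addrCA.
    by rewrite [h *: _ + _]addrC.
  by split; [exact: cvgP fx|exact: cvg_lim fx].
have [x xst ->] : exists2 x, x \in `[s, t]%R & f (p t) - f (p s) = g (p x) * (t - s).
  apply: (MVT_segment st (f := f \o p) (df := g \o p)).
    by move=> x; rewrite in_itv /= => /andP[/ltW sx /ltW xt]; apply: fd; rewrite sx.
  apply: derivable_within_continuous => x; rewrite in_itv /= => /fd [].
  by [].
rewrite normrM [`|t - s|]ger0_norm ?subr_ge0 // ler_wpM2r ?subr_ge0 //.
by move: xst; rewrite in_itv /= => /fg[].
Unshelve. all: by end_near. Qed.

Lemma icube_lipschitz u r f g L :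
  (forall a v, icube u r v -> has_pder a f v (g a v)) ->
  (forall a v, icube u r v -> `|g a v| <= L) ->
  forall y z, icube u r y -> icube u r z -> `|f y - f z| <= L * dist1 y z.
Proof.
move=> fg gL y z [uy y0] [uz z0].
(* The path from [z] to [y] changes one coordinate at a time. [q k] is its vertex after [k] changes,
   so [q 0] is [z] and [q n.+1] is [y]; [p k t] runs along the edge from [q k] to [q k.+1]. *)
pose p k (t : R) : 'rV[R]_n.+1 := \row_c
  (if (c < k)%N then y ord0 c else if c == k :> nat then t else z ord0 c).
pose q k : 'rV[R]_n.+1 := \row_c (if (c < k)%N then y ord0 c else z ord0 c).
have pE (k : 'I_n.+1) t : p k t = p k 0 + t *: delta_mx ord0 k.
  apply/rowP => c; rewrite !mxE eqxx /= val_eqE.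
  case: ltngtP => [ck|ck|/ord_inj->]; rewrite ?eqxx ?mulr1 ?add0r //;
    by rewrite -val_eqE ?(ltn_eqF ck) ?(gtn_eqF ck) ?mulr0 ?addr0.
have pz (k : 'I_n.+1) : q k = p k (z ord0 k).
  apply/rowP => c; rewrite !mxE; case: ltngtP => // /ord_inj -> //.
have py (k : 'I_n.+1) : q k.+1 = p k (y ord0 k).
  apply/rowP => c; rewrite !mxE ltnS leq_eqVlt; case: ltngtP => // /ord_inj -> //.
have pI (k : 'I_n.+1) t : (y ord0 k <= t <= z ord0 k) || (z ord0 k <= t <= y ord0 k) ->
    icube u r (p k t).
  move=> yzt; split=> [c|]; last first.
    rewrite /= mxE; case: ltngtP => // k0.
    by move: yzt; rewrite -(ord_inj k0) => /orP[] /andP[+ _]; exact: lt_le_trans.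
  rewrite mxE; case: ltngtP => // /ord_inj ->.
  have := uy k; have := uz k; rewrite !ltr_distl.
  by move=> /andP[? ?] /andP[? ?]; move: yzt => /orP[] /andP[? ?]; apply/andP; split; lra.
have step (k : 'I_n.+1) : `|f (q k.+1) - f (q k)| <= L * `|y ord0 k - z ord0 k|.
  rewrite py pz (pE _ (y _ _)) (pE _ (z _ _)).
  have [zy|/ltW yz] := leP (z ord0 k) (y ord0 k).
    rewrite [`|y _ _ - _|]ger0_norm ?subr_ge0 //.
    apply: (axis_lipschitz (g := g k)) => // x zxy; rewrite -pE.
    have px : icube u r (p k x) by apply: pI; rewrite zxy orbT.
    by split; [case: px|exact: fg|exact: gL].
  rewrite distrC [`|y _ _ - _|]distrC [`|z _ _ - _|]ger0_norm ?subr_ge0 //.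
  apply: (axis_lipschitz (g := g k)) => // x zxy; rewrite -pE.
  have px : icube u r (p k x) by apply: pI; rewrite zxy.
  by split; [case: px|exact: fg|exact: gL].
have qn k : (k <= n.+1)%N ->
    `|f (q k) - f z| <= L * \sum_(c < n.+1 | (c < k)%N) `|y ord0 c - z ord0 c|.
  elim: k => [_|k IH kn].
    rewrite big_pred0 // mulr0 (_ : q 0%N = z) ?subrr ?normr0 //.
    by apply/rowP => c; rewrite !mxE.
  rewrite (bigD1 (Ordinal kn)) //= mulrDr.
  rewrite -(subrK (f (q k)) (f (q k.+1))) -addrA.
  apply: le_trans (ler_normD _ _) _; apply: lerD; first exact: (step (Ordinal kn)).
  have := IH (ltnW kn); congr (_ <= L * _); apply: eq_bigl => c.
  by rewrite ltnS -val_eqE /= [in RHS]leq_eqVlt andbC; case: ltngtP.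
have := qn _ (leqnn _); rewrite (_ : q n.+1 = y).
  by congr (_ <= L * _); apply: eq_bigl => c; rewrite ltn_ord.
by apply/rowP => c; rewrite !mxE ltn_ord.
Qed.

(** Push both points inward by the same [t] in direction 0. Their distance is unchanged, the
    interior inequality applies to the shifted points, and by continuity each shift costs less than
    [e / 2] once [t] is small. *)
Lemma hcube_lipschitz u r f g L :
  (forall v, hcube u r v -> hcts f v) ->
  (forall a v, icube u r v -> has_pder a f v (g a v)) ->
  (forall a v, icube u r v -> `|g a v| <= L) ->
  forall y z, hcube u r y -> hcube u r z -> `|f y - f z| <= L * dist1 y z.
Proof.
move=> fc fg gL y z uy uz; apply/ler_addgt0Pr => e e0.
have e20 : 0 < e / 2 by rewrite divr_gt0.
pose q y (t : R) := y + t *: delta_mx ord0 ord0.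
have shift x : hcube u r x -> \forall t \near 0^'+,
    icube u r (q x t) /\ `|f x - f (q x t)| < e / 2.
  move=> ux.
  have xc : hnbhs x (fun v => hcube u r v /\ `|f x - f v| < e / 2).
    apply: filterI; first exact: (ropen_hnbhs (ropen_hcube u r)).
    by have /cvgrPdist_lt := fc x ux; exact.
  move/hnbhs_cubeP: xc => [s s0 sP]; exists s => //= t; rewrite /= sub0r normrN => ts t0.
  have Hx : 0 <= x ord0 ord0 by case: ux.
  have x0 : 0 < (q x t) ord0 ord0.
    by rewrite !mxE !eqxx mulr1 ltr_wpDl.
  have [//|c|[qu _] ?] := sP (q x t).
  - exact: ltW.
  - rewrite !mxE addrAC subrr add0r eqxx /=.
    by case: (c == ord0); rewrite ?mulr1 // mulr0 normr0.
  by split=> //; split.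
have [ys zs] := (shift _ uy, shift _ uz).
near (0 : R)^'+ => t.
have [yI yt] : icube u r (q y t) /\ `|f y - f (q y t)| < e / 2 by near: t.
have [zI zt] : icube u r (q z t) /\ `|f z - f (q z t)| < e / 2 by near: t.
have := icube_lipschitz fg gL yI zI.
have -> : dist1 (q y t) (q z t) = dist1 y z.
  by apply: eq_bigr => c _; rewrite !mxE; congr `|_|; ring.
have : `|f y - f z| <= `|f y - f (q y t)| + (`|f (q y t) - f (q z t)| + `|f z - f (q z t)|).
  rewrite [`|f z - _|]distrC.
  have -> : f y - f z = (f y - f (q y t)) + ((f (q y t) - f (q z t)) + (f (q z t) - f z)) by ring.
  by apply: le_trans (ler_normD _ _) _; rewrite lerD2l ler_normD.
by lra.
Unshelve. all: by end_near. Qed.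

Definition has_frechet f u (l : 'I_n.+1 -> R) := forall e, 0 < e ->
  \forall y \near hnbhs u,
    `|f y - f u - \sum_c l c * (y ord0 c - u ord0 c)| <= e * dist1 y u.

(* Derivatives are only required at interior points near [u]: this is what makes
   the one-sided derivatives at a boundary point come for free. *)
Lemma has_frechet_interior f g u : H u ->
  (\forall v \near hnbhs u, hcts f v) ->
  (\forall v \near hnbhs u, 0 < (v : 'rV[R]_n.+1) ord0 ord0 -> forall a, has_pder a f v (g a v)) ->
  (forall a, hcts (g a) u) -> has_frechet f u (g^~ u).
Proof.
move=> Hu fc fg gc e e0.
have ge : \forall v \near hnbhs u, forall a, `|g a v - g a u| <= e.
  apply: filter_forall => a; have /cvgrPdist_le := gc a.
  by move=> /(_ e e0); apply: filterS => v; rewrite distrC.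
have [r r0 rP] := hcube_near (filterI (filterI fc fg) ge).
(* Subtracting the candidate linear part leaves a function with gradient [g - g u], which is at most
   [e] near [u]. The mean value inequality for [F] is then the required estimate of the
   remainder. *)
pose F (v : 'rV[R]_n.+1) := f v + - \sum_c g c u * v ord0 c.
have := @hcube_lipschitz u r F (fun a (v : 'rV[R]_n.+1) => g a v + - (\sum_c (0 * v ord0 c + g c u * (a == c)%:R))) e.
have Fc v : hcube u r v -> hcts F v.
  move=> uv; apply: hctsD; first by have [[]] := rP v uv.
  apply: (cvgN (f := fun w : 'rV[R]_n.+1 => \sum_c g c u * w ord0 c)).
  by apply: hcts_sum => c; apply: hctsM; [exact: hcts_cst|exact: hcts_coord].
move=> /(_ Fc) FL.
have {}FL : forall y z, hcube u r y -> hcube u r z -> `|F y - F z| <= e * dist1 y z.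
  apply: FL => a v uv.
    have [[_ /(_ uv.2) fgv] _] := rP v (icube_hcube uv).
    apply: has_pderD => //; apply: has_pderN; apply: has_pder_sum => c _.
    by apply: has_pderM; [exact: has_pder_cst|exact: has_pder_coord].
  have [_ /(_ a)] := rP v (icube_hcube uv); congr (`|_ - _| <= _).
  rewrite (bigD1 a) //= big1 ?eqxx ?mul0r ?add0r ?mulr1 ?addr0 // => c /negPf.
  by rewrite eq_sym => ->; rewrite mul0r mulr0 addr0.
apply: filterS (near_hcube u r0) => y uy.
have := FL y u uy (hcube_center r0 Hu); congr (`|_| <= _).
rewrite /F; under [in RHS]eq_bigr do rewrite mulrBr.
by rewrite sumrB; ring.
Qed.

Lemma dist1_line a u h : dist1 (u + h *: delta_mx ord0 a) u = `|h|.
Proof.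
rewrite /dist1 (bigD1 a) //= big1 => [|c /negPf ca].
  by rewrite !mxE !eqxx mulr1 addrAC subrr add0r addr0.
by rewrite !mxE ca mulr0 addr0 subrr normr0.
Qed.

Lemma has_frechet_pder a f u l : has_frechet f u l -> has_pder a f u (l a).
Proof.
move=> fl; apply/cvgrPdist_le => e e0; near=> h.
have hn0 : h != 0 by near: h; exact: near_dnbhs_neq0.
have : `|f (u + h *: delta_mx ord0 a) - f u -
    \sum_c l c * ((u + h *: delta_mx ord0 a) ord0 c - u ord0 c)| <=
    e * dist1 (u + h *: delta_mx ord0 a) u.
  by near: h; exact: (hnbhs_line a (fl e e0)).
rewrite dist1_line (bigD1 a) //= big1 => [|c /negPf ca]; last first.
  by rewrite !mxE ca mulr0 addr0 subrr mulr0.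
rewrite !mxE !eqxx mulr1 addr0 [u _ _ + h]addrC addrK => hP.
rewrite distrC -(ler_pM2r (x := `|h|)) ?normr_gt0 // -normrM.
apply: le_trans hP; rewrite /diff_quot mulrBl mulrAC mulVf // mul1r.
by [].
Unshelve. all: by end_near. Qed.

(** The outer function is differentiated totally, the inner one along a single coordinate line. The
    error [q h] of the difference quotient is the Fréchet remainder at
    [G (w + h *: delta_mx ord0 a)] divided by [h], and it is small because the quotients of the
    components of [G] stay bounded. *)
Lemma has_pder_comp a f (G : 'rV[R]_n.+1 -> 'rV[R]_n.+1) w l (m : 'I_n.+1 -> R) :
  H w -> has_frechet f (G w) l ->
  (forall c, has_pder a (fun v => G v ord0 c) w (m c)) ->
  (G @ hnbhs w --> hnbhs (G w)) ->
  has_pder a (f \o G) w (\sum_c m c * l c).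
Proof.
move=> Hw fl Gm Gc.
pose q h := diff_quot a (f \o G) w h - \sum_c diff_quot a (fun v => G v ord0 c) w h * l c.
have Gl : (fun h => G (w + h *: delta_mx ord0 a)) @ half_space_dnbhs a w --> hnbhs (G w).
  by apply: cvg_comp Gc; exact: line_cvg.
have sc : (fun h => \sum_c diff_quot a (fun v => G v ord0 c) w h * l c) @
    half_space_dnbhs a w --> \sum_c m c * l c.
  by apply: cvg_big => [|c _]; [exact: add_continuous|apply: cvgM; [exact: Gm|exact: cvg_cst]].
have q0 : q @ half_space_dnbhs a w --> (0 : R).
  apply/cvgrPdist_le => e e0.
  (* Each component quotient is eventually within 1 of its limit, so [K] bounds the sum of their
     absolute values. *)
  pose K := \sum_c (`|m c| + 1); have K0 : 0 < K + 1.
    by rewrite ltr_wpDl // sumr_ge0 // => c _; rewrite addr_ge0.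
  have Gb : \forall h \near half_space_dnbhs a w, forall c,
      `|diff_quot a (fun v => G v ord0 c) w h| <= `|m c| + 1.
    apply: filter_forall => c; have /cvgrPdist_le := Gm c => /(_ 1 ltr01).
    apply: filterS => h mh.
    by rewrite -lerBlDl; apply: le_trans mh; rewrite distrC; exact: lerB_dist.
  have fe := Gl _ (fl (e / (K + 1)) (divr_gt0 e0 K0)).
  near=> h; rewrite sub0r normrN.
  have hn0 : h != 0 by near: h; exact: near_dnbhs_neq0.
  have Gbh : forall c, `|diff_quot a (fun v => G v ord0 c) w h| <= `|m c| + 1 by near: h.
  have : `|f (G (w + h *: delta_mx ord0 a)) - f (G w) -
      \sum_c l c * (G (w + h *: delta_mx ord0 a) ord0 c - G w ord0 c)| <=
      e / (K + 1) * dist1 (G (w + h *: delta_mx ord0 a)) (G w) by near: h.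
  have -> : f (G (w + h *: delta_mx ord0 a)) - f (G w) -
      \sum_c l c * (G (w + h *: delta_mx ord0 a) ord0 c - G w ord0 c) = h * q h.
    rewrite /q /diff_quot mulrBr mulrA divff // mul1r; congr (_ - _).
    by rewrite mulr_sumr; apply: eq_bigr => c _; field.
  have -> : dist1 (G (w + h *: delta_mx ord0 a)) (G w) =
      `|h| * \sum_c `|diff_quot a (fun v => G v ord0 c) w h|.
    rewrite mulr_sumr; apply: eq_bigr => c _.
    by rewrite /diff_quot -normrM mulrA divff // mul1r.
  rewrite normrM mulrCA ler_pM2l ?normr_gt0 // => /le_trans; apply.
  rewrite mulrAC ler_pdivrMr // ler_pM2l //.
  by apply: (@le_trans _ _ K); [exact: ler_sum|rewrite lerDl].
apply: (@cvg_near _ _ _ _ (fun h => q h + \sum_c diff_quot a (fun v => G v ord0 c) w h * l c)).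
  by rewrite -[X in _ --> X]add0r; exact: cvgD.
by near=> h; rewrite subrK.
Unshelve. all: by end_near. Qed.

Lemma smooth_has_frechet k V f u : ropen V -> Ck_on k.+1 V f -> V u ->
  has_frechet f u (fun a => pder a f u).
Proof.
move=> oV fk Vu; apply: (@has_frechet_interior f (fun a => pder a f)).
- exact: ropen_sub oV Vu.
- by apply: filterS (ropen_hnbhs oV Vu) => v; exact: Ck_on_hcts fk.
- by apply: filterS (ropen_hnbhs oV Vu) => v Vv _ a; exact: Ck_on_cvg fk Vv.
- by move=> a; exact: Ck_on_hcts oV (Ck_on_pder a fk) Vu.
Qed.

Lemma hcts_row (G : 'rV[R]_n.+1 -> 'rV[R]_n.+1) w :
  (\forall v \near hnbhs w, H (G v)) ->
  (forall c, hcts (fun v => G v ord0 c) w) -> G @ hnbhs w --> hnbhs (G w).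
Proof.
move=> GH Gc A /hnbhs_cubeP[r r0 rA].
have Gr : \forall v \near hnbhs w, forall c, `|G v ord0 c - G w ord0 c| < r.
  apply: filter_forall => c; have /cvgrPdist_lt := Gc c => /(_ r r0).
  by apply: filterS => v; rewrite distrC.
by apply: filterS2 GH Gr => v; exact: rA.
Qed.

Lemma Ck_on_comp k V W f (G : 'rV[R]_n.+1 -> 'rV[R]_n.+1) :
  ropen V -> ropen W -> (forall w, W w -> V (G w)) ->
  (forall c, Ck_on k W (fun w => G w ord0 c)) -> Ck_on k V f ->
  Ck_on k W (fun w => f (G w)).
Proof.
move=> oV oW WV.
have Gc j w : (forall c, Ck_on j W (fun w => G w ord0 c)) -> W w ->
    G @ hnbhs w --> hnbhs (G w).
  move=> Gk Ww; apply: hcts_row.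
    by apply: filterS (ropen_hnbhs oW Ww) => v /WV; exact: ropen_sub.
  by move=> c; exact: Ck_on_hcts oW (Gk c) Ww.
have fGc j f' w : (forall c, Ck_on j W (fun w => G w ord0 c)) -> Ck_on j V f' -> W w ->
    hcts (fun w => f' (G w)) w.
  move=> Gk fk Ww; apply: cvg_comp (Gc _ _ Gk Ww) _.
  exact: Ck_on_hcts oV fk (WV _ Ww).
elim: k f => [|k IH] f Gk fk.
  by split=> //; apply/within_hcts => // w Ww; exact: fGc Gk fk Ww.
apply: (@Ck_onS_has_pder _ _ _ _ _
  (fun a w => \sum_c pder a (fun w => G w ord0 c) w * pder c f (G w))) => //.
- by move=> w Ww; exact: fGc Gk fk Ww.
- move=> a w Ww; apply: has_pder_comp.
  + exact: ropen_sub oW Ww.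
  + exact: smooth_has_frechet oV fk (WV _ Ww).
  + by move=> c; exact: Ck_on_cvg (Gk c) Ww.
  + exact: Gc Gk Ww.
- move=> a; apply: Ck_on_sum => // c _; apply: Ck_onM => //.
    exact: Ck_on_pder.
  by apply: IH; [move=> d; exact: Ck_onW|exact: Ck_on_pder].
Qed.

Lemma smooth_comp V W f (G : 'rV[R]_n.+1 -> 'rV[R]_n.+1) :
  ropen V -> ropen W -> (forall w, W w -> V (G w)) ->
  (forall c, smooth_on W (fun w => G w ord0 c)) -> smooth_on V f ->
  smooth_on W (fun w => f (G w)).
Proof. by move=> oV oW WV Gs fs k; apply: Ck_on_comp WV _ (fs k) => // c; exact: Gs. Qed.

Lemma pder_comp a V W f (G : 'rV[R]_n.+1 -> 'rV[R]_n.+1) w :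
  ropen V -> ropen W -> (forall w, W w -> V (G w)) ->
  (forall c, smooth_on W (fun w => G w ord0 c)) -> smooth_on V f -> W w ->
  pder a (fun w => f (G w)) w = \sum_c pder a (fun w => G w ord0 c) w * pder c f (G w).
Proof.
move=> oV oW WV Gs fs Ww; apply: has_pder_derive; first exact: ropen_sub oW Ww.
apply: has_pder_comp.
- exact: ropen_sub oW Ww.
- exact: smooth_has_frechet oV (fs 1%N) (WV _ Ww).
- by move=> c; exact: smooth_has_pder (Gs c) Ww.
- apply: hcts_row.
    by apply: filterS (ropen_hnbhs oW Ww) => v /WV; exact: ropen_sub.
  by move=> c; exact: smooth_hcts oW (Gs c) Ww.
Qed.

End MeanValue.

(** * Linear systems up to the boundary *)

Section LinearSystems.
Context {R : realType} {n : nat} {K : finType}.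
Implicit Types (u v x y z : 'rV[R]_n.+1) (a : 'I_n.+1)
  (V : set 'rV[R]_n.+1) (X : K -> 'rV[R]_n.+1 -> R)
  (A : 'I_n.+1 -> K -> K -> 'rV[R]_n.+1 -> R).

Notation H := (@half_space R n).

Definition linear_system V A X := forall a k u, V u ->
  has_pder a (X k) u (\sum_l A a k l u * X l u).

(** Bootstrapping: if the [X l] are of class [m], so are the right-hand sides, and these are the
    derivatives of the [X k]. *)
Lemma linear_system_smooth V A X : ropen V ->
  (forall a k l, smooth_on V (A a k l)) ->
  (forall k u, V u -> hcts (X k) u) -> linear_system V A X ->
  forall k, smooth_on V (X k).
Proof.
move=> oV As Xc XA k m; elim: m k => [|m IH] k.
  by split=> //; apply/within_hcts => // u; exact: Xc.
apply: (@Ck_onS_has_pder _ _ _ _ _ (fun a u => \sum_l A a k l u * X l u)) => //.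
- by move=> u; exact: Xc.
- by move=> a u; exact: XA.
- by move=> a; apply: Ck_on_sum => // l _; apply: Ck_onM => //; exact: As.
Qed.

Lemma dist1_ge0 y z : 0 <= dist1 y z.
Proof. exact: sumr_ge0. Qed.

Lemma dist1_triangle x y z : dist1 x z <= dist1 x y + dist1 y z.
Proof.
rewrite /dist1 -big_split /=; apply: ler_sum => c _.
exact: ler_distD.
Qed.

Lemma dist1C y z : dist1 y z = dist1 z y.
Proof. by apply: eq_bigr => c _; rewrite distrC. Qed.

Lemma dist1_refl y : dist1 y y = 0.
Proof. by rewrite /dist1 big1 // => c _; rewrite subrr normr0. Qed.

(* McShane's formula: [F u] is the infimum of [f v + L * dist1 u v], [v] in [S]. *)
Lemma lipschitz_extension (S : set 'rV[R]_n.+1) (f : 'rV[R]_n.+1 -> R) (L : R) :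
  S !=set0 -> 0 <= L ->
  (forall y z, S y -> S z -> `|f y - f z| <= L * dist1 y z) ->
  exists F : 'rV[R]_n.+1 -> R, (forall y, S y -> F y = f y) /\
    forall y z, `|F y - F z| <= L * dist1 y z.
Proof.
move=> [s0 Ss0] L0 fL; pose T u := [set f v + L * dist1 u v | v in S].
have T0 u : T u !=set0 by exists (f s0 + L * dist1 u s0), s0.
have Tlb u v w : S v -> S w -> f v - L * dist1 u v <= f w + L * dist1 u w.
  move=> Sv Sw; have := fL v w Sv Sw; rewrite ler_norml => /andP[_].
  have := dist1_triangle v u w; rewrite (dist1C v u).
  move=> /(ler_wpM2l L0); rewrite mulrDr; lra.
have Tb u : has_lbound (T u).
  by exists (f s0 - L * dist1 u s0) => _ [v Sv <-]; exact: Tlb.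
exists (fun u => inf (T u)); split=> [y Sy|].
  apply/eqP; rewrite eq_le; apply/andP; split.
    by apply: ge_inf => //; exists y => //; rewrite dist1_refl mulr0 addr0.
  apply: lb_le_inf => // _ [v Sv <-].
  by have := Tlb y y v Sy Sv; rewrite dist1_refl mulr0 subr0.
have half y z : inf (T y) - L * dist1 y z <= inf (T z).
  apply: lb_le_inf => // _ [v Sv <-].
  have : inf (T y) <= f v + L * dist1 y v by apply: ge_inf => //; exists v.
  have := dist1_triangle y z v; move=> /(ler_wpM2l L0); rewrite mulrDr; lra.
move=> y z; rewrite ler_norml; have := half y z; have := half z y.
by rewrite (dist1C z y) => ? ?; apply/andP; split; lra.
Qed.

Lemma lipschitz_hcts (F : 'rV[R]_n.+1 -> R) (L : R) u :
  (forall y z, `|F y - F z| <= L * dist1 y z) -> hcts F u.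
Proof.
move=> FL; apply/cvgrPdist_le => e e0.
have L1 : 0 < `|L| + 1 by rewrite ltr_wpDl.
have d0 : 0 < e / ((`|L| + 1) * n.+1%:R) by rewrite divr_gt0 // mulr_gt0.
apply: filterS (near_hcube u d0) => v [uv _].
apply: le_trans (FL u v) _.
apply: (@le_trans _ _ ((`|L| + 1) * dist1 u v)).
  apply: ler_wpM2r; first exact: dist1_ge0.
  by apply: le_trans (ler_norm _) _; rewrite lerDl.
have dv : dist1 u v <= n.+1%:R * (e / ((`|L| + 1) * n.+1%:R)).
  rewrite mulr_natl -{2}(card_ord n.+1) -sumr_const; apply: ler_sum => c _.
  by rewrite distrC ltW.
apply: le_trans (ler_wpM2l (ltW L1) dv) _.
by rewrite 3!mulrA [_ * e]mulrC mulfK // mulf_neq0 ?pnatr_eq0 // lt0r_neq0.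
Qed.

(* The logarithm of [\sum_k X k ^+ 2] is Lipschitz, so this sum stays between two
   positive constants up to the boundary. *)
Lemma linear_system_bounded A X x r C : 0 < r ->
  (forall a k l v, icube x r v -> `|A a k l v| <= C) ->
  linear_system (icube x r) A X ->
  (forall v, icube x r v -> exists k, X k v != 0) -> icube x r !=set0 ->
  exists m B : R, [/\ 0 < m, 0 <= B,
    forall v, icube x r v -> m <= \sum_k X k v ^+ 2 &
    forall k v, icube x r v -> `|X k v| <= B].
Proof.
move=> r0 AC XA Xn0 [z0 z0I].
(* The sign of [C] comes from evaluating a coefficient, which requires an index in [K]; one is
   supplied later by a nonzero component at [z0]. *)
have C0 : K -> 0 <= C by move=> k; apply: le_trans (AC ord0 k k z0 z0I).
pose F v := \sum_k X k v * X k v.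
have FE v : F v = \sum_k X k v ^+ 2 by [].
have F0 v : icube x r v -> 0 < F v.
  move=> /Xn0[k Xk]; rewrite /F (bigD1 k) //= ltr_pwDl //.
    by rewrite -expr2 exprn_even_gt0.
  by apply: sumr_ge0 => l _; rewrite -expr2 sqr_ge0.
pose Xd a k v := \sum_l A a k l v * X l v.
(* The derivative of [F] is at most the double sum of [2 * C * |X k| * |X l|], hence of
   [C * (X k ^+ 2 + X l ^+ 2)], and that sum equals [2 * C * #|K| * F]. Dividing by [F] gives this
   bound for the derivative of [ln F]. *)
pose L := 2 * C * #|K|%:R.
have lnF : forall y z, icube x r y -> icube x r z ->
    `|ln (F y) - ln (F z)| <= L * dist1 y z.
  apply: (@icube_lipschitz _ _ x r (fun v => ln (F v))
    (fun a v => (F v)^-1 * \sum_k (Xd a k v * X k v + X k v * Xd a k v))).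
    move=> a v vI; apply: (@has_pder_comp1 _ _ _ (@ln R)).
      exact: is_derive1_ln (F0 v vI).
    by apply: has_pder_sum => k _; apply: has_pderM; exact: XA.
  move=> a v vI; rewrite normrM normfV (gtr0_norm (F0 v vI)) mulrC.
  rewrite ler_pdivrMr ?F0 //; apply: le_trans (ler_norm_sum _ _ _) _.
  have -> : L * F v = \sum_(k : K) \sum_(l : K) C * (X k v * X k v + X l v * X l v).
    have -> : \sum_(k : K) \sum_(l : K) C * (X k v * X k v + X l v * X l v) =
        \sum_(k : K) (C * (X k v * X k v) * #|K|%:R + C * F v).
      apply: eq_bigr => k _; rewrite -mulr_sumr big_split /= sumr_const -/(F v).
      by rewrite -mulr_natr; ring.
    rewrite big_split /= sumr_const -mulr_suml -mulr_sumr -/(F v) -mulr_natr /L; ring.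
  apply: ler_sum => k _.
  rewrite -[X in `|_ + X|]mulrC -mulr2n normrMn -mulr_natl normrM.
  have Xdk : `|Xd a k v| <= \sum_l C * `|X l v|.
    apply: le_trans (ler_norm_sum _ _ _) _; apply: ler_sum => l _.
    by rewrite normrM ler_wpM2r // AC.
  apply: (@le_trans _ _ (2 * ((\sum_l C * `|X l v|) * `|X k v|))).
    by rewrite ler_wpM2l ?ler0n // ler_wpM2r.
  rewrite mulr_suml mulr_sumr; apply: ler_sum => l _.
  have -> : 2 * (C * `|X l v| * `|X k v|) = C * (2 * `|X l v| * `|X k v|) by ring.
  rewrite ler_wpM2l ?C0 // -!expr2 -(real_normK (num_real (X k v))).
  rewrite -(real_normK (num_real (X l v))) -subr_ge0.
  have -> : `|X k v| ^+ 2 + `|X l v| ^+ 2 - 2 * `|X l v| * `|X k v| =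
    (`|X k v| - `|X l v|) ^+ 2 by ring.
  exact: sqr_ge0.
have [k0 _] := Xn0 z0 z0I; have {}C0 := C0 k0.
have L0 : 0 <= L by rewrite /L !mulr_ge0.
(* Two points of the cube differ by less than [2 * r] in each of the [n.+1] coordinates. *)
pose D := L * (n.+1%:R * (2 * r)).
have lnD v : icube x r v -> `|ln (F v) - ln (F z0)| <= D.
  move=> vI; apply: le_trans (lnF v z0 vI z0I) _; rewrite ler_wpM2l //.
  rewrite mulr_natl -{1}(card_ord n.+1) -sumr_const; apply: ler_sum => c _.
  have [[/(_ c) + _] [/(_ c) + _]] := (vI, z0I).
  by rewrite !ltr_distl ler_norml => /andP[? ?] /andP[? ?]; apply/andP; split; lra.
exists (expR (ln (F z0) - D)), (1 + expR (ln (F z0) + D)); split.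
- exact: expR_gt0.
- by rewrite addr_ge0 // ltW // expR_gt0.
- move=> v vI; rewrite -FE -[F v]lnK ?posrE ?F0 // ler_expR.
  by have := lnD v vI; rewrite ler_norml => /andP[? ?]; lra.
- move=> k v vI; have FB : F v <= expR (ln (F z0) + D).
    rewrite -[F v]lnK ?posrE ?F0 // ler_expR.
    by have := lnD v vI; rewrite ler_norml => /andP[? ?]; lra.
  (* The inequality [|t| <= 1 + t ^+ 2] passes from the sum of squares to a single component without
     square roots; it explains the summand 1 in the witness for [B]. *)
  apply: (@le_trans _ _ (1 + F v)); last by rewrite lerD2l.
  apply: (@le_trans _ _ (1 + X k v ^+ 2)).
    rewrite -(real_normK (num_real (X k v))) -subr_ge0.
    have -> : 1 + `|X k v| ^+ 2 - `|X k v| = (`|X k v| - 2^-1) ^+ 2 + 3 / 4 by field.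
    by rewrite addr_ge0 ?sqr_ge0 // divr_ge0.
  rewrite lerD2l /F (bigD1 k) //= -expr2 lerDl; apply: sumr_ge0 => l _.
  by rewrite -expr2 sqr_ge0.
Qed.

(** On a small cube both the coefficients and the solution are bounded, so the right-hand sides are
    bounded and every component is Lipschitz. A Lipschitz function extends continuously across the
    boundary by McShane's formula, and the system then promotes continuity to smoothness. *)
Lemma linear_system_extension A X x r : 0 < r -> x ord0 ord0 = 0 ->
  (forall a k l, smooth_on (hcube x r) (A a k l)) ->
  linear_system (icube x r) A X ->
  (forall v, icube x r v -> exists k, X k v != 0) ->
  exists s Y, [/\ 0 < s <= r, forall k v, icube x s v -> Y k v = X k v,
    forall k, smooth_on (hcube x s) (Y k), linear_system (hcube x s) A Y &
    exists k, Y k x != 0].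
Proof.
move=> r0 x0 As XA Xn0.
have Hx : H x by rewrite /half_space /= x0.
(* By continuity at [x] every coefficient exceeds its absolute value at [x] by at most 1 nearby; the
   sum gives one constant for all of them. *)
pose C := \sum_a \sum_k \sum_l `|A a k l x| + 1.
have AC : \forall v \near hnbhs x, forall a k l, `|A a k l v| <= C.
  apply: filter_forall => a; apply: filter_forall => k; apply: filter_forall => l.
  have /cvgrPdist_le := smooth_hcts (ropen_hcube x r) (As a k l) (hcube_center r0 Hx).
  move=> /(_ 1 ltr01); apply: filterS => v Av.
  apply: (@le_trans _ _ (`|A a k l x| + 1)).
    by rewrite -lerBlDl; apply: le_trans Av; rewrite distrC; exact: lerB_dist.
  rewrite lerD2r (bigD1 a) //= (bigD1 k) //= (bigD1 l) //= -!addrA lerDl.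
  by rewrite !addr_ge0 //; repeat (apply: sumr_ge0 => ? _).
have [t t0 tC] := hcube_near AC.
pose s := Order.min r t.
have s0 : 0 < s by rewrite lt_min r0.
have sr : s <= r by rewrite ge_min lexx.
have sub q q' v : q <= q' -> cube x q v -> cube x q' v.
  by move=> qq' vq c; exact: lt_le_trans (vq c) qq'.
have sC v : hcube x s v -> forall a k l, `|A a k l v| <= C.
  by move=> [vs Hv]; apply: tC; split=> //; apply: sub vs; rewrite ge_min lexx orbT.
have sI v : icube x s v -> icube x r v by move=> [/(sub _ _ _ sr) ? ?]; split.
have sH v : hcube x s v -> hcube x r v by move=> [/(sub _ _ _ sr) ? ?]; split.
have zI : icube x s !=set0.
  exists (x + (s / 2) *: delta_mx ord0 ord0); split=> [c|] /=; rewrite !mxE eqxx /=.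
    rewrite addrAC subrr add0r; case: (c == ord0); rewrite ?mulr1 ?mulr0 ?normr0 //.
    by rewrite gtr0_norm ?divr_gt0 // ltr_pdivrMr // ltr_pMr // ltr1n.
  by rewrite x0 add0r mulr1 divr_gt0.
have XAs : linear_system (icube x s) A X by move=> a k u /sI; exact: XA.
have [m [B [m0 B0 mX XB]]] : exists m B : R, [/\ 0 < m, 0 <= B,
    forall v, icube x s v -> m <= \sum_k X k v ^+ 2 &
    forall k v, icube x s v -> `|X k v| <= B].
  apply: (@linear_system_bounded A X x s C) => //.
    by move=> a k l v /icube_hcube /sC; exact.
  by move=> v /sI; exact: Xn0.
have C0 : 0 <= C.
  by rewrite /C addr_ge0 //; repeat (apply: sumr_ge0 => ? _).
pose L := \sum_(l : K) C * B.
have L0 : 0 <= L by apply: sumr_ge0 => l _; rewrite mulr_ge0.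
have Xlip k y z : icube x s y -> icube x s z -> `|X k y - X k z| <= L * dist1 y z.
  apply: icube_lipschitz; first by move=> a v; exact: XAs.
  move=> a v vI /=; apply: le_trans (ler_norm_sum _ _ _) _; apply: ler_sum => l _.
  by rewrite normrM ler_pM ?XB // sC //; exact: icube_hcube.
have /choice[Y YP] : forall k, exists F : 'rV[R]_n.+1 -> R,
    (forall y, icube x s y -> F y = X k y) /\
    forall y z, `|F y - F z| <= L * dist1 y z.
  by move=> k; apply: (lipschitz_extension zI L0); exact: Xlip.
have YX k v : icube x s v -> Y k v = X k v by have [+ _] := YP k; exact.
have Yc k v : hcts (Y k) v by have [_ /lipschitz_hcts] := YP k; exact.
have YA : linear_system (hcube x s) A Y.
  move=> a k u uH.
  have oH := ropen_hcube x s.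
  have oI := ropen_icube x s.
  apply: (@has_frechet_pder _ _ a _ _ (fun a => \sum_l A a k l u * Y l u)).
  (* The equation is known for interior points only. Since [Y] is continuous, so is the right-hand
     side, and the derivatives at boundary points follow. *)
  apply: (@has_frechet_interior _ _ _ (fun a u => \sum_l A a k l u * Y l u)).
  - exact: ropen_sub oH uH.
  - by apply: filterS (ropen_hnbhs oH uH) => v _.
  - apply: filterS (ropen_hnbhs oH uH) => v [vs _] v0 b.
    have vI : icube x s v by split.
    apply: (has_pder_near (ropen_sub oI vI) (f := X k)).
      by apply: (ropen_near_eq oI vI) => w wI; rewrite YX.
    under eq_bigr do rewrite YX //.
    exact: XAs.
  - move=> b; apply: hcts_sum => l; apply: hctsM => //.
    exact: smooth_hcts (ropen_hcube x r) (As b k l) (sH _ uH).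
have Ys k : smooth_on (hcube x s) (Y k).
  apply: (@linear_system_smooth _ A) => //; first exact: ropen_hcube.
  move=> a l1 l2; apply: smooth_sub (As a l1 l2) => //; exact: ropen_hcube.
exists s, Y; split=> //; first by rewrite s0.
(* If all components vanished at [x], the sum of their squares would tend to 0 along the inward
   normal, against the lower bound [m] in the interior. *)
apply: contrapT => /forallNP Y0.
have {}Y0 k : Y k x = 0 by apply/eqP/negPn/negP; exact: Y0.
pose P v := \sum_k Y k v * Y k v.
have Pc : hcts P x by apply: hcts_sum => k; exact: hctsM.
have Px : P x = 0 by rewrite /P big1 // => k _; rewrite Y0 mulr0.
have /cvgrPdist_lt/(_ m m0) Pm := Pc.
have PF := half_space_dnbhs_proper ord0 Hx.
near (half_space_dnbhs ord0 x) => h.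
have hn0 : h != 0 by near: h; exact: near_dnbhs_neq0.
have : `|P x - P (x + h *: delta_mx ord0 ord0)| < m.
  by near: h; exact: (hnbhs_line ord0 Pm).
have [vs] : hcube x s (x + h *: delta_mx ord0 ord0).
  by near: h; exact: (hnbhs_line ord0 (near_hcube x s0)).
rewrite /half_space /= !mxE !eqxx mulr1 x0 add0r => h0.
have vI : icube x s (x + h *: delta_mx ord0 ord0).
  by split=> //=; rewrite !mxE !eqxx mulr1 x0 add0r lt_def hn0.
rewrite Px sub0r normrN ltNge => /negP; apply.
apply: le_trans (mX _ vI) _; apply: le_trans (ler_norm _).
by rewrite /P; apply: ler_sum => k _; rewrite YX.
Unshelve. all: by end_near. Qed.

End LinearSystems.

(** * Charts, boundary and one-forms *)

Section Charts.
Context {R : realType} {n : nat} {M : bmanifold R n}.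
Implicit Types (i j k : chart M) (u v : 'rV[R]_n.+1) (N U : set M)
  (a b c : 'I_n.+1).

Notation H := (@half_space R n).

Lemma ropen_openI (B : set 'rV[R]_n.+1) : open B -> ropen (B `&` H).
Proof.
move=> oB; split=> [u []//|u [Bu _]].
have nB : nbhs u B by exact: open_nbhs_nbhs.
by have : nbhs u (fun v => H v -> (B `&` H) v) by apply: filterS nB => v ? ?; split.
Qed.

Lemma imgP N i u : img N i u <-> (coord i @` dom i) u /\ N (param i u).
Proof.
split=> [[x [dx Nx] <-]|[[x dx <-]]]; first by rewrite coordK //; split=> //; exists x.
by rewrite coordK // => Nx; exists x.
Qed.

Lemma img_dom N i u : img N i u -> dom i (param i u).
Proof. by move=> [x [dx _] <-]; rewrite coordK. Qed.

Lemma img_coord N i u : img N i u -> coord i (param i u) = u.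
Proof. by move=> [x [dx _] <-]; rewrite coordK. Qed.

Lemma img_param N i u : img N i u -> N (param i u).
Proof. by move=> [x [dx Nx] <-]; rewrite coordK. Qed.

Lemma img_sub N U i : N `<=` U -> img N i `<=` img U i.
Proof. by move=> NU u [x [dx /NU Ux] <-]; exists x. Qed.

Lemma img_setT N i u : img N i u -> img [set: M] i u.
Proof. exact: img_sub. Qed.

Lemma coord_in_img N i x : dom i x -> N x -> img N i (coord i x).
Proof. by move=> dx Nx; exists x. Qed.

Lemma ropen_coord_dom i : ropen (coord i @` dom i).
Proof. by have [B oB ->] := coord_img i; exact: ropen_openI. Qed.

Lemma ropen_img N i : open N -> ropen (img N i).
Proof.
move=> oN; split=> [u [x [dx _] <-]|u /imgP[du Nu]].
  by apply: (ropen_sub (ropen_coord_dom i)); exists x.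
have /subspace_continuousP/(_ u du) pc := @param_continuous _ _ M i.
rewrite (within_ropen (ropen_coord_dom i) du) in pc.
have nN : nbhs (param i u) N by exact: open_nbhs_nbhs.
apply: (filterS2 _ _ (ropen_hnbhs (ropen_coord_dom i) du) (pc _ nN)) => v dv Nv.
by apply/imgP.
Qed.

Lemma ropen_imgT i : ropen (img [set: M] i).
Proof. exact/ropen_img/openT. Qed.

Lemma ropen_img_dom N i j : open N -> ropen (img (N `&` dom j) i).
Proof. by move=> oN; apply: ropen_img; apply: openI => //; exact: dom_open. Qed.

Lemma param_trans N i j u : img (N `&` dom j) i u -> param j (trans i j u) = param i u.
Proof. by move=> /img_param[_ dj]; rewrite /trans coordK. Qed.

Lemma img_trans N i j u : img (N `&` dom j) i u -> img (N `&` dom i) j (trans i j u).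
Proof.
move=> iu; have [Nx dj] := img_param iu.
by apply: coord_in_img => //; split=> //; exact: img_dom iu.
Qed.

Lemma smooth_trans N i j c : open N ->
  smooth_on (img (N `&` dom j) i) (fun u => trans i j u ord0 c).
Proof.
move=> oN; apply: (smooth_sub _ _ _ (transition_smooth i j c)).
- by apply: ropen_img; exact: dom_open.
- exact: ropen_img_dom.
- by apply: img_sub => x [].
Qed.

Lemma smooth_comp_trans N i j (f : 'rV[R]_n.+1 -> R) : open N ->
  smooth_on (img N j) f ->
  smooth_on (img (N `&` dom j) i) (fun u => f (trans i j u)).
Proof.
move=> oN; apply: smooth_comp => [||u iu|c].
- exact: ropen_img.
- exact: ropen_img_dom.
- by apply: img_sub (img_trans iu) => x [].
- exact: smooth_trans.
Qed.

Lemma smooth_jacobian N i j a c : open N ->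
  smooth_on (img (N `&` dom j) i) (fun u => jacobian i j u a c).
Proof.
move=> oN; have sp := smooth_pder a (smooth_trans i j c oN).
apply: smooth_eq sp; first exact: ropen_img_dom.
by move=> u _; rewrite mxE.
Qed.

Lemma pder_comp_trans N i j a (f : 'rV[R]_n.+1 -> R) u : open N ->
  smooth_on (img N j) f -> img (N `&` dom j) i u ->
  pder a (fun w => f (trans i j w)) u =
  \sum_c jacobian i j u a c * pder c f (trans i j u).
Proof.
move=> oN fs iu; under eq_bigr do rewrite mxE.
apply: (@pder_comp _ _ a (img N j) (img (N `&` dom j) i)) => //.
- exact: ropen_img.
- exact: ropen_img_dom.
- by move=> w /img_trans; apply: img_sub => x [].
- by move=> c; exact: smooth_trans.
Qed.

(** The chain rule for transition maps. Rows belong to the source coordinates, so the factors stand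
    in the order in which the charts are passed. *)
Lemma jacobian_cocycle i j k u : img (dom j `&` dom k) i u ->
  jacobian i k u = jacobian i j u *m jacobian j k (trans i j u).
Proof.
move=> iu; have oj := dom_open j; have ok := dom_open k.
apply/matrixP => a c; rewrite !mxE.
have iu' : img (dom k `&` dom j) i u by apply: img_sub iu => x [].
have jk := pder_comp_trans a ok (transition_smooth j k c) iu'.
under eq_bigr do rewrite [X in _ * X]mxE.
rewrite -jk; have on : ropen (img (dom k `&` dom j) i) by exact: ropen_img_dom.
apply: (pder_near _ (ropen_sub on iu')).
apply: (ropen_near_eq on iu') => v /img_param[_ dj].
by rewrite /trans coordK.
Qed.

Lemma jacobian_refl i u : img [set: M] i u -> jacobian i i u = 1%:M.
Proof.
move=> iu; apply/matrixP => a c; rewrite !mxE.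
have on := ropen_imgT i; have Hu := ropen_sub on iu.
rewrite (has_pder_derive Hu (l := (a == c)%:R)) //.
apply: (has_pder_near (f := fun v => v ord0 c) Hu); last exact: has_pder_coord.
by apply: (ropen_near_eq on iu) => v /img_coord; rewrite /trans => ->.
Qed.

Lemma jacobian_inv i j u : img (dom j) i u ->
  jacobian i j u *m jacobian j i (trans i j u) = 1%:M.
Proof.
move=> iu; rewrite -jacobian_cocycle; last first.
  by apply/imgP; have /imgP[? ?] := iu; split=> //; split=> //; exact: img_dom iu.
by apply: jacobian_refl; exact: img_setT iu.
Qed.

(** At an interior point both signs of [h] are admissible: the quotients are nonnegative from the
    right and nonpositive from the left. *)
Lemma has_pder_argmin a (f : 'rV[R]_n.+1 -> R) u l : 0 < u ord0 ord0 ->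
  (\forall v \near hnbhs u, f u <= f v) -> has_pder a f u l -> l = 0.
Proof.
move=> u0 fm; have Hu : H u := ltW u0.
have fml := hnbhs_line a fm.
rewrite /has_pder; move: fml; rewrite half_space_dnbhs_interior // => fml fl.
have fr : diff_quot a f u @ 0^'+ --> l by apply: cvg_dnbhs_at_right.
have fL : diff_quot a f u @ 0^'- --> l by apply: cvg_dnbhs_at_left.
have Hr : \forall h \near (0 : R)^'+, f u <= f (u + h *: delta_mx ord0 a).
  by move: fml => [r r0 rP]; exists r => // h hr h0; apply: rP => //; rewrite gt_eqF.
have Hl : \forall h \near (0 : R)^'-, f u <= f (u + h *: delta_mx ord0 a).
  by move: fml => [r r0 rP]; exists r => // h hr h0; apply: rP => //; rewrite lt_eqF.
apply/eqP; rewrite eq_le; apply/andP; split.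
  apply: (closed_cvg _ (@closed_le _ 0) _ _ fL).
  near=> h; have h0 : h < 0 by near: h; exact: nbhs_left_lt.
  rewrite /= /diff_quot mulr_le0_ge0 ?invr_le0 ?(ltW h0) // subr_ge0.
  by near: h.
apply: (closed_cvg _ (@closed_ge _ 0) _ _ fr).
near=> h; have h0 : 0 < h by near: h; exact: nbhs_right_gt.
rewrite /= /diff_quot mulr_ge0 ?invr_ge0 ?(ltW h0) // subr_ge0.
by near: h.
Unshelve. all: by end_near. Qed.

(* If [x] were a boundary point in chart [j] and an interior point in chart [i],
   the function [trans i j _ ord0 ord0] would have an interior minimum, so the
   invertible matrix [jacobian i j] would have a zero column. *)
Lemma boundary_coord i x : boundary M x -> dom i x -> coord i x ord0 ord0 = 0.
Proof.
move=> [j dj x0] di; set u := coord i x.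
have iu : img (dom j) i u by apply: coord_in_img.
have oi : ropen (img (dom j) i) by apply: ropen_img; exact: dom_open.
have tu : trans i j u = coord j x by rewrite /trans coordK.
have := ropen_sub oi iu; rewrite /half_space /= le_eqVlt => /orP[/eqP <- //|u0].
have st : smooth_on (img (dom j) i) (fun w => trans i j w ord0 ord0).
  exact: transition_smooth.
have J0 a : jacobian i j u a ord0 = 0.
  rewrite mxE; apply: (has_pder_argmin u0 _ (smooth_has_pder (a := a) st iu)).
  apply: filterS (ropen_hnbhs oi iu) => v iv.
  rewrite tu x0.
  have dv := img_dom iv; have djv := img_param iv.
  have jv : img [set: M] j (trans i j v) by apply: coord_in_img.
  exact: (ropen_sub (ropen_imgT j) jv).
(* In the reversed product the matrix with vanishing column 0 is the right factor, so the entry at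
   [(ord0, ord0)] would be 0 instead of 1. *)
have := mulmx1C (jacobian_inv iu) => /matrixP/(_ ord0 ord0).
rewrite !mxE big1 => [|c _]; last by rewrite J0 mulr0.
by move=> /esym/eqP; rewrite oner_eq0.
Qed.

Lemma boundary_param i u : img [set: M] i u -> boundary M (param i u) <-> u ord0 ord0 = 0.
Proof.
move=> iu; have du := img_dom iu; split=> [bu|u0].
  by have := boundary_coord bu du; rewrite (img_coord iu).
by exists i => //; rewrite (img_coord iu).
Qed.

Lemma minterior_param i u : img [set: M] i u -> minterior M (param i u) <-> 0 < u ord0 ord0.
Proof.
move=> iu; have := ropen_sub (ropen_imgT i) iu; rewrite /half_space /= => u0.
rewrite /minterior /=; split=> [nb|ugt /(boundary_param iu)]; last first.
  by move=> u00; rewrite u00 ltxx in ugt.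
by rewrite lt_def u0 andbT; apply/eqP => u00; apply: nb; exact/boundary_param.
Qed.

Lemma img_minterior N i u : img (N `&` minterior M) i u <-> img N i u /\ 0 < u ord0 ord0.
Proof.
split=> [iu|[iu u0]].
  split; first by apply: img_sub iu => x [].
  by have [_] := img_param iu; apply: (minterior_param (img_setT iu)).1.
apply/imgP; have /imgP[? ?] := iu; split=> //; split=> //.
exact/(minterior_param (img_setT iu)).
Qed.

Lemma img_minteriorT i u : img (minterior M) i u <-> img [set: M] i u /\ 0 < u ord0 ord0.
Proof. by rewrite -{1}(setTI (minterior M)); exact: img_minterior. Qed.

Lemma ropen_pos V : ropen V -> ropen (V `&` [set u : 'rV[R]_n.+1 | 0 < u ord0 ord0]).
Proof.
move=> oV; split=> [u [_ /ltW]//|u [Vu u0]].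
apply: filterI; first exact: ropen_hnbhs.
by have : nbhs u (fun v => H v -> [set w : 'rV[R]_n.+1 | 0 < w ord0 ord0] v);
  first by apply: filterS (pos_open u0) => v.
Qed.

Lemma ropen_img_minterior N i : open N -> ropen (img (N `&` minterior M) i).
Proof.
move=> oN; have -> : img (N `&` minterior M) i =
    img N i `&` [set u : 'rV[R]_n.+1 | 0 < u ord0 ord0].
  by apply/seteqP; split=> u /img_minterior.
by apply: ropen_pos; exact: ropen_img.
Qed.

Lemma ropen_img_minteriorT i : ropen (img (minterior M) i).
Proof. by rewrite -(setTI (minterior M)); exact/ropen_img_minterior/openT. Qed.

(** A connection needs components in every chart, whereas the forms constructed below come from a
    formula in a single chart [i0]; this transports them to the other charts over [dom i0]. *)
Definition pullback i0 (th : 'I_n.+1 -> 'rV[R]_n.+1 -> R) : covector_comp M :=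
  fun j a u => \sum_c jacobian j i0 u a c * th c (trans j i0 u).

Lemma one_form_pullback N i0 th : open N -> N `<=` dom i0 ->
  (forall a, smooth_on (img N i0) (th a)) -> one_form N (pullback i0 th).
Proof.
move=> oN Nd ths; have NE : N `&` dom i0 = N by apply/setIidPl.
split=> [j a|j k u iu a].
  apply: smooth_sum; first exact: ropen_img.
  move=> c _; apply: smoothM; first exact: ropen_img.
    by rewrite -NE; exact: smooth_jacobian.
  by rewrite -{1}NE; exact: smooth_comp_trans.
have iuk : img (dom k `&` dom i0) j u by apply: img_sub iu => x [/Nd].
rewrite /pullback (jacobian_cocycle iuk).
under eq_bigr do rewrite mxE mulr_suml.
rewrite exchange_big /=; apply: eq_bigr => c _; rewrite mulr_sumr.
apply: eq_bigr => d _; rewrite mulrA; congr (_ * th d _).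
by rewrite /trans coordK //; have [] := img_param iu.
Qed.

Lemma affine_connection_sub N U (G : christoffel M) : open N -> open U ->
  N `<=` U -> affine_connection U G -> affine_connection N G.
Proof.
move=> oN oU NU [Gs Gsym GT]; split=> [i c a b|i u iu|i j u iu].
- by apply: smooth_sub (Gs i c a b); [exact: ropen_img|exact: ropen_img|exact: img_sub].
- by apply: Gsym; exact: img_sub iu.
- by apply: GT; apply: img_sub iu => x [/NU].
Qed.

(** The second derivatives of the transition map are absorbed by the law for [G]; the added terms
    are tensorial and symmetric in the two lower indices. *)
Lemma affine_connection_proj_change N (G : christoffel M) Ups : open N ->
  affine_connection N G -> one_form N Ups -> affine_connection N (proj_change G Ups).
Proof.
move=> oN [Gs Gsym GT] [Us UT]; split=> [i c a b|i u iu c a b|i j u iu c a b].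
- have oi := ropen_img i oN.
  apply: smoothD => //; first apply: smoothD => //; apply: smoothM => //;
    exact: smooth_cst.
- by rewrite /proj_change (Gsym i u iu c a b); ring.
rewrite /proj_change.
transitivity ((\sum_d jacobian i j u d c * G i d a b u) +
    (Ups i a u * jacobian i j u b c + Ups i b u * jacobian i j u a c)).
  rewrite (eq_bigr (fun d => jacobian i j u d c * G i d a b u +
    (Ups i a u * (jacobian i j u d c * (b == d)%:R) +
     Ups i b u * (jacobian i j u d c * (a == d)%:R)))); last by move=> d _; ring.
  rewrite big_split big_split /= -!mulr_sumr; congr (_ + (_ * _ + _ * _)).
    rewrite (bigD1 b) //= eqxx mulr1 big1 ?addr0 // => d /negPf.
    by rewrite eq_sym => ->; rewrite mulr0.
  rewrite (bigD1 a) //= eqxx mulr1 big1 ?addr0 // => d /negPf.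
  by rewrite eq_sym => ->; rewrite mulr0.
rewrite GT // -addrA; congr (_ + _).
pose tu := trans i j u; rewrite -/tu.
transitivity ((\sum_e \sum_f jacobian i j u a e * jacobian i j u b f * G j c e f tu) +
  ((\sum_e \sum_f jacobian i j u a e * jacobian i j u b f * (Ups j e tu * (f == c)%:R)) +
   (\sum_e \sum_f jacobian i j u a e * jacobian i j u b f * (Ups j f tu * (e == c)%:R)))).
  congr (_ + (_ + _)).
    rewrite (UT _ _ _ iu) mulr_suml; apply: eq_bigr => e _.
    rewrite (bigD1 c) //= eqxx big1 ?addr0 => [|f /negPf ->]; last by rewrite !mulr0.
    by rewrite /tu mulr1; ring.
  rewrite exchange_big (UT _ _ _ iu) mulr_suml; apply: eq_bigr => f _ /=.
  rewrite (bigD1 c) //= eqxx big1 ?addr0 => [|e /negPf ->]; last by rewrite !mulr0.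
  by rewrite /tu mulr1; ring.
rewrite -!big_split /=; apply: eq_bigr => e _; rewrite -!big_split /=.
by apply: eq_bigr => f _; ring.
Qed.

End Charts.

(** * Projective change of the Ricci tensor *)

Lemma sum_delta (R : pzRingType) (I : finType) (i : I) (F : I -> R) :
  \sum_j F j * (i == j)%:R = F i.
Proof.
rewrite (bigD1 i) //= eqxx mulr1 big1 ?addr0 // => j /negPf.
by rewrite eq_sym => ->; rewrite mulr0.
Qed.

Lemma sum_deltar (R : pzRingType) (I : finType) (i : I) (F : I -> R) :
  \sum_j F j * (j == i)%:R = F i.
Proof. by under eq_bigr do rewrite eq_sym; exact: sum_delta. Qed.

(** The pointwise algebra behind the change of the Ricci tensor: [t] stands for the Christoffel
    symbols at a point, [U] for the one-form and [E a b] for the derivative of [U b] in direction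
    [a]. Its left-hand side omits the derivatives of [t], which are common to both Ricci tensors. *)
Lemma ricci_change_algebra (R : comPzRingType) (n : nat)
    (t : 'I_n.+1 -> 'I_n.+1 -> 'I_n.+1 -> R) (U : 'I_n.+1 -> R)
    (E : 'I_n.+1 -> 'I_n.+1 -> R) (b d : 'I_n.+1) :
  (forall c a b, t c a b = t c b a) ->
  let g c a b := t c a b + U a * (b == c)%:R + U b * (a == c)%:R in
  \sum_a ((E a b * (d == a)%:R + E a d * (b == a)%:R) -
          (E b a * (d == a)%:R + E b d * (a == a)%:R) +
          \sum_e (g a a e * g e b d - g a b e * g e a d)) =
  (\sum_a \sum_e (t a a e * t e b d - t a b e * t e a d)) +
  (E d b - n.+1%:R * E b d + n%:R * ((\sum_e U e * t e b d) + U b * U d)).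
Proof.
move=> tS g; pose tau e := \sum_a t a a e.
have gsum (F : 'I_n.+1 -> R) a c :
    \sum_e F e * g e a c = (\sum_e F e * t e a c) + F c * U a + F a * U c.
  rewrite -(sum_delta c (fun e => F e * U a)) -(sum_delta a (fun e => F e * U c)).
  by rewrite -!big_split; apply: eq_bigr => e _ /=; rewrite /g; ring.
have E1 : \sum_a \sum_e g a a e * g e b d =
    (\sum_a \sum_e t a a e * t e b d) + n.+2%:R * (\sum_e U e * t e b d) +
    (tau d + n.+2%:R * U d) * U b + (tau b + n.+2%:R * U b) * U d.
  have trg e : \sum_a g a a e = tau e + n.+2%:R * U e.
    rewrite /g; under eq_bigr do rewrite eqxx mulr1.
    rewrite !big_split /= sum_delta sumr_const card_ord -/(tau e) -[n.+2]addn1 natrD.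
    by rewrite -mulr_natl; ring.
  rewrite exchange_big /=; under eq_bigr do rewrite -mulr_suml trg.
  rewrite gsum; congr (_ + _ + _).
  rewrite [\sum_a \sum_e t a a e * _]exchange_big mulr_sumr -big_split /=.
  by apply: eq_bigr => e _; rewrite -mulr_suml -/(tau e); ring.
(* Compared with [E1], the terms in [tau] cancel, the contraction of [U] with [t] keeps the factor
   [n.+2 - 2], and [U b * U d] keeps [2 * n.+2 - n.+4]; both factors are [n]. *)
have E2 : \sum_a \sum_e g a b e * g e a d =
    (\sum_a \sum_e t a b e * t e a d) + 2%:R * (\sum_e U e * t e b d) +
    U b * tau d + U d * tau b + n.+4%:R * (U b * U d).
  have inner a : \sum_e g a b e * g e a d =
      (\sum_e t a b e * t e a d) + U b * t a a d +
      (\sum_e U e * t e a d) * (b == a)%:R + U a * t a b d +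
      (U b * U a) * (d == a)%:R + (U a * U d) * (b == a)%:R +
      U d * t a a b + U b * U d + (U a * U d) * (b == a)%:R.
    rewrite gsum (_ : \sum_e g a b e * t e a d =
      (\sum_e t a b e * t e a d) + U b * t a a d + (\sum_e U e * t e a d) * (b == a)%:R).
      by rewrite /g eqxx (tS a b a) /=; ring.
    rewrite -(sum_deltar a (fun e => U b * t e a d)) mulr_suml -!big_split /=.
    by apply: eq_bigr => e _; rewrite /g; ring.
  under eq_bigr do rewrite inner.
  rewrite !big_split /= !sum_delta -!mulr_sumr sumr_const card_ord -!/(tau _).
  by rewrite -[n.+4]addn3 -mulr_natl natrD; ring.
transitivity ((\sum_a (E a b * (d == a)%:R + E a d * (b == a)%:R) -
    \sum_a (E b a * (d == a)%:R + E b d * (a == a)%:R)) +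
    ((\sum_a \sum_e g a a e * g e b d) - \sum_a \sum_e g a b e * g e a d)).
  rewrite -!sumrB -big_split /=; apply: eq_bigr => a _; by rewrite -sumrB.
have -> : \sum_a \sum_e (t a a e * t e b d - t a b e * t e a d) =
    (\sum_a \sum_e t a a e * t e b d) - \sum_a \sum_e t a b e * t e a d.
  by rewrite -sumrB; apply: eq_bigr => a _; rewrite sumrB.
rewrite E1 E2 !big_split /= !sum_delta; under [X in _ - (_ + X)]eq_bigr do rewrite eqxx mulr1.
rewrite sumr_const card_ord -[_ *+ n.+1]mulr_natl.
by rewrite -[n.+4]addn4 -[n.+2]addn2 -natr1 !natrD; ring.
Qed.

Section FlatScale.
Context {R : realType} {n : nat} {M : bmanifold R n}.
Variables (i : chart M) (V : set 'rV[R]_n.+1) (T G : christoffel M)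
  (Ups : covector_comp M).
Hypotheses (oV : ropen V) (Ts : forall c a b, smooth_on V (T i c a b))
  (Tsym : forall u, V u -> forall c a b, T i c a b u = T i c b a u)
  (Us : forall a, smooth_on V (Ups i a))
  (GT : forall u, V u -> forall c a b, G i c a b u = proj_change T Ups i c a b u).

Lemma pder_proj_change a b c d u : V u -> pder a (G i c b d) u =
  pder a (T i c b d) u + (pder a (Ups i b) u * (d == c)%:R +
                          pder a (Ups i d) u * (b == c)%:R).
Proof.
move=> Vu; apply: (has_pder_derive (ropen_sub oV Vu)).
apply: (has_pder_near (ropen_sub oV Vu) (f := proj_change T Ups i c b d)).
  by apply: (ropen_near_eq oV Vu) => v Vv; rewrite GT.
rewrite addrA; apply: has_pderD; first apply: has_pderD.
- exact: smooth_has_pder (Ts c b d) Vu.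
- rewrite -[X in has_pder _ _ _ X]addr0 -[X in _ + X](mulr0 (Ups i b u)).
  by apply: has_pderM; [exact: smooth_has_pder (Us b) Vu|exact: has_pder_cst].
- rewrite -[X in has_pder _ _ _ X]addr0 -[X in _ + X](mulr0 (Ups i d u)).
  by apply: has_pderM; [exact: smooth_has_pder (Us d) Vu|exact: has_pder_cst].
Qed.

(** In covariant terms the correction is
    $\nabla_d\Upsilon_b-(n+1)\nabla_b\Upsilon_d+n\Upsilon_b\Upsilon_d$ with $\nabla$ belonging to
    [T]; as [T] is symmetric, the Christoffel terms of the two derivatives combine to the factor
    [n]. *)
Lemma ricci_proj_change b d u : V u -> ricci G i b d u = ricci T i b d u +
  (pder d (Ups i b) u - n.+1%:R * pder b (Ups i d) u +
   n%:R * ((\sum_e Ups i e u * T i e b d u) + Ups i b u * Ups i d u)).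
Proof.
move=> Vu; rewrite /ricci /riemann [in RHS]big_split /= -addrA.
rewrite -(@ricci_change_algebra _ n (fun c a b => T i c a b u)
  (fun a => Ups i a u) (fun a b => pder a (Ups i b) u) b d); last first.
  by move=> *; exact: Tsym.
rewrite /= -big_split /=; apply: eq_bigr => a _; rewrite !pder_proj_change //.
under eq_bigr do rewrite !GT //.
rewrite /proj_change; ring.
Qed.

(** With the weights [n.+1] and 1 in [schouten] the transposed derivative $\nabla_b\Upsilon_a$
    cancels, and $(n+1)^2-1=n(n+2)$ matches the denominator. *)
Lemma schouten_proj_flat (n_gt0 : (0 < n)%N) u : V u ->
  (forall a b, ricci G i a b u = 0) -> forall a b,
  schouten T i a b u = pder a (Ups i b) u -
    (\sum_e Ups i e u * T i e a b u) - Ups i a u * Ups i b u.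
Proof.
move=> Vu G0 a b; rewrite /schouten.
have n0 : n%:R != 0 :> R by rewrite pnatr_eq0 -lt0n.
have n2 : n.+2%:R != 0 :> R by rewrite pnatr_eq0.
apply: (mulIf (mulf_neq0 n0 n2)); rewrite divfK ?mulf_neq0 //.
have := ricci_proj_change a b Vu; have := ricci_proj_change b a Vu.
rewrite !G0 (mulrC (Ups i b u)).
under [\sum_e _ * T i e b a u]eq_bigr do rewrite Tsym //.
set S := \sum_e _ => /esym/eqP; rewrite addr_eq0 => /eqP ->.
move=> /esym/eqP; rewrite addr_eq0 => /eqP ->.
rewrite -[n.+2]addn2 -[n.+1]addn1 !natrD; ring.
Qed.

End FlatScale.

(** * The scale and its jet *)

Lemma big_option (R : nmodType) (I : finType) (F : option I -> R) :
  \sum_l F l = F None + \sum_c F (Some c).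
Proof.
rewrite (bigD1 None) //=; congr (_ + _).
rewrite (reindex_omap Some id) /=; last by case.
by apply: eq_bigl => c; rewrite eqxx.
Qed.

(* The matrix of the closed system satisfied by [(s, nabla s)] for a solution [s]
   of [nabla_a nabla_b s + P_ab s = 0]; [None] stands for the component [s]. *)
Definition prolongation (R : realType) (n : nat) (M : bmanifold R n)
    (T : christoffel M) (i : chart M) (a : 'I_n.+1) (k l : option 'I_n.+1)
    (u : 'rV[R]_n.+1) : R :=
  let pT := weight_exp n (1 : R) * \sum_c T i c a c u in
  match k, l with
  | None, None => pT
  | None, Some c => (a == c)%:R
  | Some b, None => - schouten T i a b u
  | Some b, Some c => T i c a b u + pT * (b == c)%:R
  end.

Definition jet (R : realType) (n : nat) (M : bmanifold R n)
    (T : christoffel M) (s : scalar_comp M) (i : chart M) (k : option 'I_n.+1)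
    (u : 'rV[R]_n.+1) : R :=
  if k is Some b then vol_covd T (weight_exp n (1 : R)) s i b u else s i u.

(** * Smoothness of the curvature and of the prolonged system *)

Section SmoothCurvature.
Context {R : realType} {n : nat} {M : bmanifold R n}.
Variables (i : chart M) (V : set 'rV[R]_n.+1) (T : christoffel M).
Hypotheses (oV : ropen V) (Ts : forall c a b, smooth_on V (T i c a b)).

Lemma smooth_ricci a b : smooth_on V (ricci T i a b).
Proof.
apply: smooth_sum => // c _; apply: smoothD => //.
  by apply: smoothB => //; exact: smooth_pder.
by apply: smooth_sum => // e _; apply: smoothB => //; apply: smoothM.
Qed.

Lemma smooth_schouten a b : smooth_on V (schouten T i a b).
Proof.
apply: smoothM => //; last exact: smooth_cst.
apply: smoothD => //; last exact: smooth_ricci.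
by apply: smoothZ => //; exact: smooth_ricci.
Qed.

Lemma smooth_trace a : smooth_on V (fun u => \sum_c T i c a c u).
Proof. by apply: smooth_sum => // c _; exact: Ts. Qed.

Lemma smooth_prolongation a k l : smooth_on V (prolongation T i a k l).
Proof.
have pTs : smooth_on V (fun u => weight_exp n (1 : R) * \sum_c T i c a c u).
  by apply: smoothZ => //; exact: smooth_trace.
case: k l => [b|] [c|] /=.
- by apply: smoothD => //; apply: smoothM => //; exact: smooth_cst.
- by apply: smoothN => //; exact: smooth_schouten.
- exact: smooth_cst.
- exact: pTs.
Qed.

Lemma smooth_vol_covd p (s : scalar_comp M) a : smooth_on V (s i) ->
  smooth_on V (vol_covd T p s i a).
Proof.
move=> ss; apply: smoothB => //; first exact: smooth_pder.
apply: smoothM => //; apply: smoothZ => //; exact: smooth_trace.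
Qed.

Lemma smooth_vol_covd2 p (s : scalar_comp M) a b : smooth_on V (s i) ->
  smooth_on V (vol_covd2 T p s i a b).
Proof.
move=> ss; have mus c := smooth_vol_covd p c ss.
apply: smoothB => //; first apply: smoothB => //.
- exact: smooth_pder.
- by apply: smooth_sum => // c _; apply: smoothM => //; exact: Ts.
- apply: smoothM => //; apply: smoothZ => //; exact: smooth_trace.
Qed.

Lemma smooth_bgg_operator (s : scalar_comp M) a b : smooth_on V (s i) ->
  smooth_on V (bgg_operator T s i a b).
Proof.
move=> ss; apply: smoothD => //; [|apply: smoothM => //];
  (apply: smoothM; [by []| |exact: smooth_cst]); apply: smoothD => //;
  (exact: smooth_vol_covd2 || exact: smooth_schouten).
Qed.

End SmoothCurvature.

(** * The parallel scale computed relative to a member of the class *)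

Section ParallelScale.
Context {R : realType} {n : nat} {M : bmanifold R n}.
Variables (i : chart M) (V : set 'rV[R]_n.+1) (T G : christoffel M)
  (Ups : covector_comp M) (kappa s : scalar_comp M).
Hypotheses (n_gt0 : (0 < n)%N) (oV : ropen V)
  (Ts : forall c a b, smooth_on V (T i c a b))
  (Tsym : forall u, V u -> forall c a b, T i c a b u = T i c b a u)
  (Us : forall a, smooth_on V (Ups i a))
  (GT : forall u, V u -> forall c a b, G i c a b u = proj_change T Ups i c a b u)
  (G0 : forall u, V u -> forall a b, ricci G i a b u = 0)
  (ks : smooth_on V (kappa i)) (k0 : forall u, V u -> 0 < kappa i u)
  (kG : forall u, V u -> forall a, vol_covd G 1 kappa i a u = 0)
  (sk : forall u, V u -> s i u = kappa i u `^ weight_exp n (1 : R)).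

Notation p := (weight_exp n (1 : R)).

(** The projective change adds [n.+2] times [Ups] to the trace of the Christoffel symbols, and the
    exponent [p] is minus the inverse of [n.+2]; this is why [Ups] enters with coefficient exactly
    -1. *)
Lemma has_pder_scale a u : V u -> has_pder a (s i) u
  (p * (\sum_c T i c a c u) * s i u - Ups i a u * s i u).
Proof.
move=> Vu; have Hu := ropen_sub oV Vu.
apply: (has_pder_near Hu (f := fun v => kappa i v `^ p)).
  by apply: (ropen_near_eq oV Vu) => v Vv; rewrite sk.
have := has_pder_comp1 (is_derive1_powR p (k0 Vu)) (smooth_has_pder (a := a) ks Vu).
congr has_pder; have := kG Vu a; rewrite /vol_covd mul1r => /eqP.
rewrite subr_eq0 => /eqP ->; rewrite mulrA mulrAC.
have -> : p * kappa i u `^ (p - 1) * kappa i u = p * s i u.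
  rewrite -mulrA -[X in _ * (_ * X)](powRr1 (ltW (k0 Vu))) -powRD ?subrK ?sk //.
  by rewrite (lt0r_neq0 (k0 Vu)) implybT.
have -> : \sum_b G i b a b u = (\sum_b T i b a b u) + n.+2%:R * Ups i a u.
  under eq_bigr do rewrite GT // /proj_change eqxx mulr1.
  rewrite !big_split /= sum_delta sumr_const card_ord -[n.+2]addn1 natrD.
  by rewrite -[_ *+ _]mulr_natl; ring.
have -> : Ups i a u * s i u = - (p * n.+2%:R) * (Ups i a u * s i u).
  by rewrite /weight_exp divfK ?pnatr_eq0 // opprK mul1r.
by ring.
Qed.

Lemma vol_covd_scale a u : V u -> vol_covd T p s i a u = - Ups i a u * s i u.
Proof.
move=> Vu; rewrite /vol_covd (has_pder_derive (ropen_sub oV Vu) (@has_pder_scale a u Vu)).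
by rewrite mulNr addrAC subrr add0r.
Qed.

(** Differentiating [- Ups * s] produces a term quadratic in [Ups] and a derivative of [Ups]. The
    flatness identity trades both for the Schouten tensor of [T], so what remains is linear in the
    jet with coefficients free of [Ups]. *)
Lemma has_pder_vol_covd_scale a b u : V u ->
  has_pder a (vol_covd T p s i b) u
    ((\sum_c T i c a b u * vol_covd T p s i c u) +
     p * (\sum_c T i c a c u) * vol_covd T p s i b u - schouten T i a b u * s i u).
Proof.
move=> Vu; have Hu := ropen_sub oV Vu.
apply: (has_pder_near Hu (f := fun v => - Ups i b v * s i v)).
  by apply: (ropen_near_eq oV Vu) => v Vv; rewrite vol_covd_scale.
have := has_pderM (has_pderN (smooth_has_pder (a := a) (Us b) Vu)) (@has_pder_scale a u Vu).
congr has_pder.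
rewrite (schouten_proj_flat oV Ts Tsym Us GT n_gt0 Vu (G0 Vu)) vol_covd_scale //.
have -> : \sum_c T i c a b u * vol_covd T p s i c u =
    - (\sum_e Ups i e u * T i e a b u) * s i u.
  rewrite -sumrN mulr_suml; apply: eq_bigr => c _; rewrite vol_covd_scale //; ring.
by ring.
Qed.

Lemma vol_covd2_scale a b u : V u ->
  vol_covd2 T p s i a b u = - (schouten T i a b u * s i u).
Proof.
move=> Vu; rewrite /vol_covd2.
rewrite (has_pder_derive (ropen_sub oV Vu) (@has_pder_vol_covd_scale a b u Vu)).
by ring.
Qed.

Lemma bgg_operator_scale a b u : V u -> bgg_operator T s i a b u = 0.
Proof. by move=> Vu; rewrite /bgg_operator !vol_covd2_scale //; field. Qed.

Lemma linear_system_jet : linear_system V (prolongation T i) (jet T s i).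
Proof.
move=> a [b|] u Vu; rewrite big_option /=; last first.
  have := @has_pder_scale a u Vu; congr has_pder.
  under [X in _ = _ + X]eq_bigr do rewrite mulrC.
  by rewrite sum_delta vol_covd_scale //; ring.
have := @has_pder_vol_covd_scale a b u Vu; congr has_pder.
have -> : \sum_c (T i c a b u + p * (\sum_c T i c a c u) * (b == c)%:R) *
      vol_covd T p s i c u =
    \sum_c T i c a b u * vol_covd T p s i c u +
    p * (\sum_c T i c a c u) * vol_covd T p s i b u.
  rewrite -(sum_delta b (fun c => _ * vol_covd T p s i c u)) -big_split /=.
  by apply: eq_bigr => c _; ring.
by ring.
Qed.

Lemma hcts_jet k u : V u -> hcts (jet T s i k) u.
Proof.
move=> Vu; have Hu := ropen_sub oV Vu.
have ss : hcts (s i) u.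
  apply: (hcts_near Hu (f := fun v => kappa i v `^ p)).
    by apply: (ropen_near_eq oV Vu) => v Vv; rewrite sk.
  have kc := smooth_hcts oV ks Vu.
  have pc : {for kappa i u, continuous (@powR R ^~ p)}.
    apply: differentiable_continuous; apply/derivable1_diffP.
    by have [] := is_derive1_powR p (k0 Vu).
  exact: (cvg_comp _ _ kc pc).
case: k => [b|] //=.
apply: (hcts_near Hu (f := fun v => - Ups i b v * s i v)).
  by apply: (ropen_near_eq oV Vu) => v Vv; rewrite /= vol_covd_scale.
apply: hctsM => //; exact: cvgN (smooth_hcts oV (Us b) Vu).
Qed.

Lemma smooth_jet k : smooth_on V (jet T s i k).
Proof.
apply: (linear_system_smooth oV _ _ linear_system_jet) => [a k1 l1|k1 u].
  exact: smooth_prolongation.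
exact: hcts_jet.
Qed.

End ParallelScale.

(** * Boundary behaviour of the scale *)

Section MoreCharts.
Context {R : realType} {n : nat} {M : bmanifold R n}.
Implicit Types (i j : chart M) (u v : 'rV[R]_n.+1).

Lemma open_chart_cube i u (r : R) : open (dom i `&` coord i @^-1` cube u r).
Proof.
rewrite openE => y [dy yu]; rewrite /interior.
have /subspace_continuousP/(_ y dy) cc := @coord_continuous _ _ M i.
have dn : nbhs y (dom i) by apply: open_nbhs_nbhs; split=> //; exact: dom_open.
have cn : nbhs y (fun z => dom i z -> cube u r (coord i z)) := cc _ (cube_open yu).
by apply: (filterS2 _ _ dn cn) => z dz zu; split=> //; exact: zu.
Qed.

(** A boundary point is the limit of the interior points on its inward normal, so identities proved
    in the interior pass to the boundary by continuity. *)
Lemma hcts_boundary_eq0 (V : set 'rV[R]_n.+1) (f : 'rV[R]_n.+1 -> R) u :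
  ropen V -> V u -> hcts f u -> u ord0 ord0 = 0 ->
  (forall v, V v -> 0 < v ord0 ord0 -> f v = 0) -> f u = 0.
Proof.
move=> oV Vu fu u0 f0; have Hu := ropen_sub oV Vu.
have PF := half_space_dnbhs_proper ord0 Hu.
have fl : (fun h => f (u + h *: delta_mx ord0 ord0)) @ half_space_dnbhs ord0 u --> f u.
  exact: (cvg_comp _ _ (@line_cvg _ _ ord0 u) fu).
have f00 : (fun h => f (u + h *: delta_mx ord0 ord0)) @ half_space_dnbhs ord0 u --> (0 : R).
  apply: (@cvg_near _ _ _ _ (fun=> 0)); first exact: cvg_cst.
  have HV := ropen_hnbhs oV Vu; near=> h; apply/esym; apply: f0.
    by near: h; exact: (hnbhs_line ord0 HV).
  have hn0 : h != 0 by near: h; exact: near_dnbhs_neq0.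
  have : half_space (u + h *: delta_mx ord0 ord0).
    by apply: (ropen_sub oV); near: h; exact: (hnbhs_line ord0 HV).
  by rewrite /half_space /= !mxE !eqxx mulr1 u0 add0r => h0; rewrite lt_def hn0.
by rewrite -(cvg_lim _ fl) // (cvg_lim _ f00).
Unshelve. all: by end_near. Qed.

End MoreCharts.

(** * The three conclusions for a special Ricci-flat connection *)

Section FlatSpecialConnection.
Context {R : realType} {n : nat} {M : bmanifold R n}.
Variables (P : set (christoffel M)) (nabla T : christoffel M)
  (Ups : covector_comp M) (kappa : scalar_comp M).
Hypotheses (n_gt0 : (0 < n)%N) (P_proj : projective_structure P) (PT : P T)
  (Ups_form : one_form (minterior M) Ups)
  (nablaE : agree_on (minterior M) nabla (proj_change T Ups))
  (kappa_vol : vol_section 1 (minterior M) kappa)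
  (kappa_gt0 : forall i u, img (minterior M) i u -> 0 < kappa i u)
  (kappa_parallel : vol_parallel (minterior M) nabla 1 kappa)
  (nabla_flat : ricci_flat (minterior M) nabla)
  (nabla_not_ext : forall x : M, boundary M x -> ~ extends_near x nabla).

Notation p := (weight_exp n (1 : R)).
Let s : scalar_comp M := zero_extension (scalar_pow kappa p).

Lemma proj_class_affine S : P S -> affine_connection [set: M] S.
Proof. by case: P_proj => G0 _ -> []. Qed.

(** Going through the base connection of the class yields a form relating [nabla] to any other
    member [S]. The interior computation can thus be repeated relative to [S], which takes the place
    of an invariance argument for the operator. *)
Lemma proj_class_change S i : P S -> exists Ups' : covector_comp M,
  (forall a, smooth_on (img (minterior M) i) (Ups' i a)) /\
  forall u, img (minterior M) i u -> forall c a b,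
    nabla i c a b u = proj_change S Ups' i c a b u.
Proof.
have oI := ropen_img_minteriorT i.
have oT := ropen_imgT i.
move: PT P_proj => PT' [G0 _ PE]; move: PT'; rewrite PE.
move=> [_ [U1 [U1s _] TE]] [_ [U2 [U2s _] SE]].
exists (fun i a u => Ups i a u + U1 i a u - U2 i a u); split=> [a|u iu c a b].
  have sub f : smooth_on (img [set: M] i) f -> smooth_on (img (minterior M) i) f.
    by apply: smooth_sub => // v; exact: img_setT.
  apply: smoothB => //; last exact: sub.
  by apply: smoothD; [by []|case: Ups_form|exact: sub].
have iuT := img_setT iu.
rewrite nablaE // /proj_change.
have := TE _ _ iuT c a b; have := SE _ _ iuT c a b; rewrite /proj_change => -> ->.
by ring.
Qed.

Lemma scale_interior i u : img (minterior M) i u -> s i u = kappa i u `^ p.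
Proof.
by move=> /img_param iu; rewrite /s /zero_extension /scalar_pow asboolT.
Qed.

Lemma scale_boundary i u : boundary M (param i u) -> s i u = 0.
Proof. by move=> bu; rewrite /s /zero_extension asboolF //; apply. Qed.

Lemma scale_gt0 i u : img (minterior M) i u -> 0 < s i u.
Proof. by move=> iu; rewrite scale_interior // powR_gt0 // kappa_gt0. Qed.

Lemma img_interior_or_boundary i u : img [set: M] i u ->
  img (minterior M) i u \/ boundary M (param i u) /\ u ord0 ord0 = 0.
Proof.
move=> iu; have [bu|nbu] := pselect (boundary M (param i u)).
  by right; split=> //; apply/(boundary_param iu).
by left; apply/imgP; have /imgP[du _] := iu.
Qed.

Lemma scale_ge0 i u : img [set: M] i u -> 0 <= s i u.
Proof.
move=> /img_interior_or_boundary[/scale_gt0/ltW //|[/scale_boundary -> _]].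
exact: lexx.
Qed.

Lemma scale_eq0 i u : img [set: M] i u -> s i u = 0 <-> boundary M (param i u).
Proof.
move=> iu; split; last exact: scale_boundary.
have [iI|[//]] := img_interior_or_boundary iu.
by move=> s0; have := scale_gt0 iI; rewrite s0 ltxx.
Qed.

Section InClass.
Variables (S : christoffel M) (i : chart M).
Hypothesis PS : P S.

Let I := img (minterior M) i.

Lemma class_smooth c a b : smooth_on (img [set: M] i) (S i c a b).
Proof. by have [] := proj_class_affine PS. Qed.

Lemma class_smooth_interior c a b : smooth_on I (S i c a b).
Proof.
apply: smooth_sub (class_smooth c a b).
- exact: ropen_imgT.
- exact: ropen_img_minteriorT.
- by move=> u; exact: img_setT.
Qed.

Lemma class_sym u : I u -> forall c a b, S i c a b u = S i c b a u.
Proof. by have [_ Ssym _] := proj_class_affine PS => /img_setT; exact: Ssym. Qed.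

Lemma class_bgg_interior a b u : I u -> bgg_operator S s i a b u = 0.
Proof.
have [U' [U's U'E]] := proj_class_change i PS.
have [ks _] := kappa_vol.
apply: (bgg_operator_scale (V := I) n_gt0 (ropen_img_minteriorT i) class_smooth_interior
  class_sym U's U'E _ (ks i)).
- by move=> v Iv ? ?; exact: nabla_flat.
- by move=> v; exact: kappa_gt0.
- by move=> v Iv ?; exact: kappa_parallel.
- by move=> v; exact: scale_interior.
Qed.

End InClass.

Let I i := img (minterior M) i.

Lemma T_change i u : I i u -> forall c a b,
  nabla i c a b u = proj_change T Ups i c a b u.
Proof. by move=> iu c a b; rewrite nablaE. Qed.

Lemma Ups_smooth i a : smooth_on (I i) (Ups i a).
Proof. by case: Ups_form. Qed.

Lemma kappa_smooth i : smooth_on (I i) (kappa i).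
Proof. by case: kappa_vol. Qed.

Lemma scale_covd i a u : I i u -> vol_covd T p s i a u = - Ups i a u * s i u.
Proof.
apply: (vol_covd_scale (V := I i) (ropen_img_minteriorT i)
  (@T_change i) (kappa_smooth i) (@kappa_gt0 i) _ (@scale_interior i)).
by move=> v Iv b; exact: kappa_parallel.
Qed.

Lemma scale_linear_system i : linear_system (I i) (prolongation T i) (jet T s i).
Proof.
apply: (linear_system_jet (V := I i) n_gt0 (ropen_img_minteriorT i)
  (class_smooth_interior i PT)
  (@class_sym _ i PT) (@Ups_smooth i) (@T_change i) _ (kappa_smooth i)
  (@kappa_gt0 i) _ (@scale_interior i)).
- by move=> v Iv ? ?; exact: nabla_flat.
- by move=> v Iv b; exact: kappa_parallel.
Qed.

Lemma scale_smooth_interior i : smooth_on (I i) (s i).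
Proof.
apply: (smooth_jet (V := I i) n_gt0 (ropen_img_minteriorT i)
  (class_smooth_interior i PT)
  (@class_sym _ i PT) (@Ups_smooth i) (@T_change i) _ (kappa_smooth i)
  (@kappa_gt0 i) _ (@scale_interior i) None).
- by move=> v Iv ? ?; exact: nabla_flat.
- by move=> v Iv b; exact: kappa_parallel.
Qed.

Lemma Ups_pullback i j a u : img (dom i `&` minterior M) j u ->
  Ups j a u = \sum_c jacobian j i u a c * Ups i c (trans j i u).
Proof. by rewrite setIC => ju; have [_ UT] := Ups_form; rewrite (UT _ _ _ ju). Qed.

Lemma trans_interior i j u : img (dom i `&` minterior M) j u -> I i (trans j i u).
Proof. by rewrite setIC => /img_trans; apply: img_sub => x []. Qed.

(* A nonzero boundary value of the scale would make the one-form relating [T] and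
   [nabla], which is minus the logarithmic derivative of the scale, smooth up to
   the boundary. *)
Lemma extends_near_scale i (W : set 'rV[R]_n.+1)
    (Y : option 'I_n.+1 -> 'rV[R]_n.+1 -> R) u :
  ropen W -> W `<=` img [set: M] i -> (forall k, smooth_on W (Y k)) ->
  (forall k v, W v -> 0 < v ord0 ord0 -> Y k v = jet T s i k v) ->
  W u -> Y None u != 0 -> extends_near (param i u) nabla.
Proof.
move=> oW WI Ys YE Wu Yu.
have : hnbhs u (fun v => W v /\ Y None v != 0).
  apply: filterI; first exact: ropen_hnbhs.
  have /cvgrPdist_lt := smooth_hcts oW (Ys None) Wu.
  move=> /(_ `|Y None u|); rewrite normr_gt0 => /(_ Yu).
  by apply: filterS => v; apply: contraTneq => ->; rewrite subr0 ltxx.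
move=> /hcube_near[r r0 rW].
pose U : set M := dom i `&` coord i @^-1` cube u r.
have oU : open U by exact: open_chart_cube.
have Ud : U `<=` dom i by move=> x [].
have UW v : img U i v -> W v /\ Y None v != 0.
  move=> iv; have [_] := img_param iv; rewrite /= (img_coord iv) => vr.
  by apply: rW; split=> //; exact: ropen_sub (ropen_img i oU) iv.
have Uu : U (param i u).
  have iu := WI u Wu; split; first exact: img_dom iu.
  by rewrite /= (img_coord iu); exact: cube_center.
pose th a v := - Y (Some a) v * (Y None v)^-1.
have ths a : smooth_on (img U i) (th a).
  have sY k : smooth_on (img U i) (Y k).
    by apply: smooth_sub (Ys k) => //; [exact: ropen_img|move=> v /UW[]].
  have oi := ropen_img i oU.
  apply: smoothM => //; first exact: smoothN.
  by apply: smoothV => // v /UW[].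
exists U => //.
have fU := one_form_pullback oU Ud ths.
exists (proj_change T (pullback i th)).
  apply: affine_connection_proj_change => //.
  apply: affine_connection_sub (proj_class_affine PT) => //; exact: openT.
move=> j v jv c a b.
have jvI : img (dom i `&` minterior M) j v by apply: img_sub jv => x [[]].
have jvM : I j v by apply: img_sub jv => x [].
rewrite T_change // /proj_change.
have thU e : pullback i th j e v = Ups j e v.
  rewrite (Ups_pullback e jvI); apply: eq_bigr => d _; congr (_ * _).
  set w := trans j i v.
  have wI : I i w := trans_interior jvI.
  have wU : img U i w.
    have jv' : img ((U `&` minterior M) `&` dom i) j v.
      by apply: img_sub jv => x [[? ?] ?].
    by apply: img_sub (img_trans jv') => x [[]].
  have [wW Yw] := UW w wU.
  have [_ w0] := (img_minteriorT i w).1 wI.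
  rewrite /th !(YE _ w) //= scale_covd //.
  by rewrite -mulNr opprK mulfK // lt0r_neq0 // scale_gt0.
by rewrite !thU.
Qed.

Lemma scale_near_boundary i x : boundary M x -> dom i x ->
  exists W, [/\ ropen W, W (coord i x), smooth_on W (s i) &
    exists a, pder a (s i) (coord i x) != 0].
Proof.
move=> bx dx; set u := coord i x.
have iu : img [set: M] i u by exact: coord_in_img.
have u0 : u ord0 ord0 = 0 by exact: boundary_coord.
have oi := ropen_imgT i.
have Hu := ropen_sub oi iu.
have [r r0 rI] := hcube_near (ropen_hnbhs oi iu).
have icI v : icube u r v -> I i v.
  by move=> vr; apply/img_minteriorT; split; [apply: rI; exact: icube_hcube|case: vr].
have [|||q [Y [/andP[q0 qr] YX Ys YA [k Yk]]]] :=
  @linear_system_extension _ _ _ (prolongation T i) (jet T s i) u r r0 u0.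
- move=> a k l.
  have ps := smooth_prolongation oi (class_smooth i PT) a k l.
  by apply: smooth_sub ps => //; exact: ropen_hcube.
- by move=> a k v /icI; exact: scale_linear_system.
- by move=> v /icI vI; exists None; rewrite /= lt0r_neq0 // scale_gt0.
have oq := ropen_hcube u q.
have qI v : hcube u q v -> img [set: M] i v.
  by move=> [vq Hv]; apply: rI; split=> // c; exact: lt_le_trans (vq c) qr.
have YE k' v : hcube u q v -> 0 < v ord0 ord0 -> Y k' v = jet T s i k' v.
  by move=> [vq _] v0; apply: YX; split.
(* The non-extension hypothesis is applied at every boundary point of the cube, not just at its
   centre: the smooth extension vanishes at each of them and therefore coincides with the extension
   by zero. *)
have sY v : hcube u q v -> Y None v = s i v.
  move=> vq; have [/img_minteriorT[_ v0]|[bv v0]] := img_interior_or_boundary (qI v vq).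
    by rewrite YE.
  rewrite scale_boundary //; apply/eqP/negPn/negP => Yv.
  exact: (nabla_not_ext bv (extends_near_scale oq qI Ys YE vq Yv)).
have uq : hcube u q u by exact: hcube_center.
have Y0 : Y None u = 0.
  by rewrite sY // scale_boundary // /u coordK.
exists (hcube u q); split=> //; first by apply: smooth_eq (Ys None).
(* The component that is nonzero at [u] must be a covariant derivative of the scale; as the scale
   itself is 0 there, it equals the partial derivative. *)
case: k Yk => [b|]; last by rewrite Y0 eqxx.
move=> Yb; exists b.
rewrite -(pder_near _ Hu (ropen_near_eq oq uq sY)).
rewrite (has_pder_derive Hu (YA b None u uq)) big_option /= Y0 mulr0 add0r.
by under eq_bigr do rewrite mulrC; rewrite sum_delta.
Qed.

Lemma scale_smooth i : smooth_on (img [set: M] i) (s i).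
Proof.
apply: smooth_local; first exact: ropen_imgT.
move=> u iu; have [Iu|[bu _]] := img_interior_or_boundary iu.
  exists (I i); split=> //; [exact: ropen_img_minteriorT|exact: scale_smooth_interior].
have [W [oW Wu sW _]] := scale_near_boundary bu (img_dom iu).
by exists W; split=> //; rewrite -(img_coord iu).
Qed.

Lemma scale_defining_function i :
  local_defining_function (dom i) (fun y => s i (coord i y)).
Proof.
have sf : smooth_fun (dom i) (fun y => s i (coord i y)).
  move=> j; rewrite -(setTI (dom i)).
  exact: (smooth_comp_trans j openT (scale_smooth i)).
split=> //.
- exact: dom_open.
- by move=> x dx; apply: scale_ge0; exact: coord_in_img.
- by move=> x dx; rewrite scale_eq0 ?coordK //; exact: coord_in_img.
(* The differential is known to be nonzero in chart [i] only. If it vanished in chart [j], the chain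
   rule would make it vanish in chart [i] too. *)
move=> x j dx bx djx; apply: contrapT => /forallNP d0.
have [_ [_ _ _ [a /eqP]]] := scale_near_boundary bx dx; apply.
have iu : img (dom i `&` dom j) i (coord i x) by apply: coord_in_img.
have oij := ropen_img_dom (N := dom i) i j (dom_open i).
have Hu := ropen_sub oij iu.
rewrite -(pder_near _ Hu (f := fun w => s i (coord i (param j (trans i j w))))).
  rewrite (pder_comp_trans a (dom_open i) (sf j) iu) big1 // => c _.
  have /negP/negPn/eqP := d0 c; rewrite /differential /trans coordK // => ->.
  by rewrite mulr0.
apply: (ropen_near_eq oij iu) => v iv.
by rewrite (param_trans iv) (img_coord iv).
Qed.

Lemma scale_vol_section : vol_section p [set: M] s.
Proof.
split=> [i|i j u iu]; first exact: scale_smooth.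
have iuT : img [set: M] i u by exact: img_setT iu.
have pt := param_trans iu.
have jt : img [set: M] j (trans i j u) by exact: img_setT (img_trans iu).
have [Iu|[bu _]] := img_interior_or_boundary iuT; last first.
  by rewrite !scale_boundary ?pt // mulr0.
have jI : img (minterior M) j (trans i j u).
  by apply/imgP; rewrite pt; have /imgP[? _] := jt; split=> //; exact: img_param Iu.
have iuj : img (minterior M `&` dom j) i u.
  apply/imgP; have /imgP[? ?] := Iu; split=> //; split=> //.
  by have [] := img_param iu.
rewrite !scale_interior //; have [_ kT] := kappa_vol.
by rewrite (kT _ _ _ iuj) powRr1 // powRM // ltW // kappa_gt0.
Qed.

Lemma scale_defining_density : defining_density p s.
Proof.
split=> [|x i dx|x i bx dx]; first exact: scale_vol_section.
  by rewrite scale_eq0 ?coordK //; exact: coord_in_img.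
by exists (dom i); [split|left; exact: scale_defining_function].
Qed.

Lemma nabla_projectively_compact : projectively_compact 1 nabla.
Proof.
split=> [|x [i dx x0]]; first exact: ltr01.
exists (dom i), (fun y => s i (coord i y)); split=> //.
  exact: scale_defining_function.
have od := dom_open i.
(* Written out in chart [i], the identity for the covariant derivative of the scale says that [Ups]
   plus the logarithmic derivative of the scale is [p] times the trace of [T]. So [th] is the smooth
   form by which the modified connection differs from [T]. *)
pose th a u := p * \sum_c T i c a c u.
have ths a : smooth_on (img (dom i) i) (th a).
  have oi := ropen_img i od.
  apply: smoothZ => //; apply: smooth_trace => // c a' b.
  apply: smooth_sub (class_smooth i PT c a' b) => //; first exact: ropen_imgT.
  by move=> v; exact: img_setT.
exists (proj_change T (pullback i th)).
  apply: affine_connection_proj_change => //; last exact: one_form_pullback.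
  apply: affine_connection_sub (proj_class_affine PT) => //; exact: openT.
move=> j u ju c a b.
have juM : I j u by apply: img_sub ju => y [].
have wI : I i (trans j i u) := trans_interior ju.
have juT : img ([set: M] `&` dom i) j u by apply: img_sub ju => y [].
have thU e : pullback i th j e u = Ups j e u +
    differential (fun y => s i (coord i y)) j e u / (1 * s i (coord i (param j u))).
  rewrite (Ups_pullback e ju) mul1r /differential.
  rewrite (pder_comp_trans e openT (scale_smooth i) juT).
  rewrite mulr_suml -big_split /=; apply: eq_bigr => d _.
  rewrite -/(trans j i u) -mulrA -mulrDr; congr (_ * _).
  have sd := scale_covd d wI; rewrite /vol_covd in sd.
  have s0 : s i (trans j i u) != 0 by rewrite lt0r_neq0 // scale_gt0.
  apply: (mulIf s0); rewrite mulrDl divfK // -[Ups _ _ _ * _]opprK -mulNr -sd /th.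
  by ring.
have regroup (t r q r' q' d d' : R) : t + (r + r') * d + (q + q') * d' =
    t + r * d + q * d' + r' * d + q' * d' by ring.
by rewrite /proj_change !thU T_change // /proj_change regroup.
Qed.

Lemma scale_bgg S : P S -> forall i u, img [set: M] i u ->
  forall a b, bgg_operator S s i a b u = 0.
Proof.
move=> PS i u iu a b.
have [Iu|[_ u0]] := img_interior_or_boundary iu; first exact: class_bgg_interior.
have oi := ropen_imgT i.
(* At a boundary point the operator is a continuous expression in the smooth scale, so its interior
   vanishing determines its value. *)
apply: (hcts_boundary_eq0 oi iu _ u0).
  apply: (smooth_hcts oi _ iu); apply: smooth_bgg_operator => //.
    exact: class_smooth.
  exact: scale_smooth.
by move=> v iv v0; apply: class_bgg_interior => //; apply/img_minteriorT.
Qed.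

End FlatSpecialConnection.

Theorem theorem3p3 (R : realType) (n : nat) (n_gt0 : (0 < n)%N)
    (M : bmanifold R n) (P : set (christoffel M))
    (nabla : christoffel M) (kappa : scalar_comp M)
    (P_proj : projective_structure P)
    (nabla_in_P : proj_restrict (minterior M) P nabla)
    (kappa_vol : vol_section 1 (minterior M) kappa)
    (kappa_gt0 : forall i u, img (minterior M) i u -> 0 < kappa i u)
    (kappa_parallel : vol_parallel (minterior M) nabla 1 kappa)
    (nabla_flat : ricci_flat (minterior M) nabla)
    (nabla_not_ext : forall x : M, boundary M x -> ~ extends_near x nabla) :
  let sigma : scalar_comp M :=
    zero_extension (scalar_pow kappa (- 1 / n.+2%:R)) in
  [/\ projectively_compact 1 nabla,
      defining_density (weight_exp n (1 : R)) sigma &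
      forall tnabla : christoffel M, P tnabla ->
        forall i u, img [set: M] i u ->
        forall a b, bgg_operator tnabla sigma i a b u = 0].
Proof.
have [_ [T PT [Ups Ups_form nablaE]]] := nabla_in_P.
split.
- exact: (nabla_projectively_compact (P := P) (T := T) (Ups := Ups) (kappa := kappa)).
- exact: (scale_defining_density (P := P) (T := T) (Ups := Ups) (nabla := nabla)).
- exact: (scale_bgg (P := P) (T := T) (Ups := Ups) (nabla := nabla)).
Qed.
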